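(* There exists $\Delta_0$ such that every simple graph $G$ with maximum degree $\Delta \geq \Delta_0$ satisfies $$\chi''_{\sum}(G) \leq \Delta + 139\,\Delta^{5/6}\ln^{1/6}\Delta .$$ In particular, $\chi''_{\sum}(G) \leq (1+o(1))\Delta$, where $o(1)$ denotes a quantity depending only on $\Delta$ and tending to $0$ as $\Delta\to\infty$.
   Context: Let $G=(V,E)$ be a simple graph. A proper total colouring of $G$ with colours in $\{1,\dots,k\}$ is a map $c: V\cup E\to\{1,\dots,k\}$ such that adjacent vertices receive distinct colours, edges sharing an endpoint receive distinct colours, and every edge receives a colour distinct from the colours of both its endpoints. For such $c$ and $v\in V$, the weighted degree of $v$ is $s_c(v)=c(v)+\sum_{u\in N(v)}c(uv)$. The colouring $c$ is neighbour sum distinguishing if $s_c(u)\neq s_c(v)$ for every edge $uv\in E$. The total neighbour sum distinguishing number $\chi''_{\sum}(G)$ is the least $k$ for which a neighbour sum distinguishing proper total colouring of $G$ with colours in $\{1,\dots,k\}$ exists. *)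

(* Defs.v *)
From mathcomp Require Import all_boot.
From Stdlib Require Import Reals.
Set Implicit Arguments. Unset Strict Implicit. Unset Printing Implicit Defensive.

Definition simple_graph (T : finType) (e : rel T) : Prop :=
  symmetric e /\ irreflexive e.

Definition deg (T : finType) (e : rel T) (v : T) : nat := #|[set u | e v u]|.
Definition max_deg (T : finType) (e : rel T) : nat := \max_(v : T) deg e v.

(* A total colouring: cV colours vertices, cE colours edges; an edge {u,v}
   gets colour cE u v, which must equal cE v u. *)
Definition weighted_deg (T : finType) (e : rel T) (cV : T -> nat)
  (cE : T -> T -> nat) (v : T) : nat :=
  cV v + \sum_(u : T | e v u) cE v u.

Definition nsd_total_colouring (T : finType) (e : rel T) (k : nat)
  (cV : T -> nat) (cE : T -> T -> nat) : Prop :=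
  (forall v, 1 <= cV v <= k) /\
  (forall u v, e u v -> 1 <= cE u v <= k) /\
  (forall u v, e u v -> cE u v = cE v u) /\
  (forall u v, e u v -> cV u <> cV v) /\
  (forall u v w, e u v -> e u w -> v <> w -> cE u v <> cE u w) /\
  (forall u v, e u v -> cE u v <> cV u /\ cE u v <> cV v) /\
  (forall u v, e u v -> weighted_deg e cV cE u <> weighted_deg e cV cE v).

Definition nsd_colourable (T : finType) (e : rel T) (k : nat) : Prop :=
  exists cV cE, nsd_total_colouring e k cV cE.

Definition is_tnsd_number (T : finType) (e : rel T) (k : nat) : Prop :=
  nsd_colourable e k /\ (forall k', nsd_colourable e k' -> k <= k').

(* Main.v *)
(* Vertices of degree at most Delta / 4 are coloured last: such a vertex only has to
   avoid 3 Delta / 4 colours.  The other vertices are treated as follows.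

   A random partition of the vertices into p groups gives every vertex about Delta / p
   neighbours in each group.  Edges between different groups, coloured in blocks of
   2 ^ k slightly more than Delta / p colours, and the vertices then use p + 1 blocks
   in all.  The edges inside the groups receive o(Delta) new colours: every vertex
   takes a random label y < r, and an edge uv gets a colour from the block y u + y v of
   a palette.  The label shifts the sum at a vertex of large degree by a multiple of
   its label that exceeds, up to a constant factor, all fluctuations; hence only
   O(Delta / r) neighbours of a vertex can have the same sum.  A sparse subgraph of the
   inner edges, chosen by a second random label and containing no such pair, is
   coloured greedily at the very end so as to separate the remaining pairs.

   All the random labels come from one Chernoff bound and the local lemma.  With
   Delta about b ^ 30 the parameters are 2 ^ k ~ b ^ 24, r = b ^ 7, deviations b ^ 16,
   and the number of colours is at most Delta + b ^ 25. *)

Require Import Defs.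
From HB Require Import structures.
From mathcomp Require Import all_boot zify_ssreflect.
From Stdlib Require Import Reals Lia Lra Classical_Prop.
From mathcomp Require Import ssrnat.
Set Warnings "-redundant-canonical-projection".
Set Implicit Arguments. Unset Strict Implicit. Unset Printing Implicit Defensive.

(** * Counting tools and greedy choice *)

Lemma exists_colour_avoiding (s : seq nat) (k : nat) :
  size s < k -> exists2 a, a < k & a \notin s.
Proof.
move=> hs; case: (boolP (has (fun a => a \notin s) (iota 0 k))) => [/hasP[a]|].
  by rewrite mem_iota add0n => ak an; exists a.
move/hasPn=> sub; suff: k <= size s by rewrite leqNgt hs.
rewrite -[k](size_iota 0); apply: uniq_leq_size (iota_uniq 0 k) _ => a ak.
by have := sub a ak; rewrite negbK.
Qed.

Lemma card_bigcup_le (I T : finType) (P : pred I) (A : I -> {set T}) :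
  #|\bigcup_(i | P i) A i| <= \sum_(i | P i) #|A i|.
Proof.
elim/big_rec2: _ => [|i n B _ le_Bn]; first by rewrite cards0.
by apply: leq_trans (leq_card_setU _ _) _; rewrite leq_add2l.
Qed.

(** Values are picked in the order of [enum_rank]. The forbidden list may be written in terms of the
    whole function because the locality hypothesis says that later values do not affect it; this
    lets every greedy argument below state its constraints on a complete colouring. *)
Lemma greedy_choice (I : finType) (k : nat) (forb : (I -> nat) -> I -> seq nat) :
  (forall c c' i, (forall j, enum_rank j < enum_rank i -> c j = c' j) ->
     forb c i = forb c' i) ->
  (forall c i, size (forb c i) < k) ->
  exists c : I -> nat, forall i, c i < k /\ c i \notin forb c i.
Proof.
move=> loc sz.
suff H n : n <= #|I| -> exists c : I -> nat, forall i, enum_rank i < n ->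
    c i < k /\ c i \notin forb c i.
  have [c hc] := H _ (leqnn _); exists c => i; apply: hc; apply: ltn_ord.
elim: n => [|n IHn] ltn; first by exists (fun=> 0).
have [c hc] := IHn (ltnW ltn).
pose i0 := enum_val (Ordinal ltn).
have r0 : enum_rank i0 = n :> nat by rewrite enum_valK.
have [a ak an] := exists_colour_avoiding (sz c i0).
pose c' i := if i == i0 then a else c i.
have eqc i : enum_rank i <= n -> forb c' i = forb c i.
  move=> ri; apply: loc => j rj; rewrite /c'; case: eqP => // ej.
  by move: rj; rewrite ej r0 ltnNge ri.
exists c' => i; rewrite ltnS => ri; rewrite eqc // /c'.
case: eqP => [-> //|ne]; apply: hc.
rewrite ltn_neqAle ri andbT -r0; apply/eqP => /val_inj e.
by apply: ne; apply: enum_rank_inj.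
Qed.

(** * The Lovász local lemma, by counting *)

Section LocalLemma.
Variables (T L I : finType) (A : I -> {set {ffun T -> L}}) (supp : I -> {set T}).
Variable d : nat.

Definition depends_on (S : {set T}) (X : {set {ffun T -> L}}) :=
  forall x y : {ffun T -> L}, {in S, x =1 y} -> (x \in X) = (y \in X).

Definition mix (S : {set T}) (x y : {ffun T -> L}) : {ffun T -> L} :=
  [ffun t => if t \in S then x t else y t].

(** Independence by counting pairs: exchanging the coordinates in [S] of two functions is an
    involution on pairs, and it matches [(X :&: Y)] times everything with [X] times [Y]. *)
Lemma card_setI_indep (S : {set T}) (X Y : {set {ffun T -> L}}) :
  depends_on S X -> depends_on (~: S) Y ->
  #|X :&: Y| * #|{ffun T -> L}| = #|X| * #|Y|.
Proof.
move=> dX dY.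
pose sw (p : {ffun T -> L} * {ffun T -> L}) := (mix S p.1 p.2, mix S p.2 p.1).
have swK : involutive sw.
  case=> x y; rewrite /sw /=.
  by congr pair; apply/ffunP => t; rewrite !ffunE; case: (t \in S).
rewrite -[#|{ffun _ -> _}|]cardsT -!cardsX.
rewrite -(card_imset _ (inv_inj swK)); congr #|pred_of_set _|; apply/setP => p.
rewrite -[p]swK (mem_imset _ _ (inv_inj swK)); case: p => x y.
rewrite -[sw (sw (x, y))]/(sw _) swK /= !inE /= andbT.
have -> : (mix S x y \in X) = (x \in X) by apply: dX => t tS; rewrite ffunE tS.
have -> // : (mix S x y \in Y) = (y \in Y).
by apply: dY => t; rewrite inE ffunE => /negbTE ->.
Qed.

Definition avoid (S : {set I}) := \bigcap_(j in S) ~: A j.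

Hypothesis A_supp : forall i, depends_on (supp i) (A i).
Hypothesis deg_le : forall i, #|[set j | ~~ [disjoint supp i & supp j]]| <= d.
Hypothesis A_small : forall i, 4 * d * #|A i| <= #|{ffun T -> L}|.
Hypothesis Omega_gt0 : 0 < #|{ffun T -> L}|.

Lemma avoid_depends (S : {set I}) (U : {set T}) :
  {in S, forall j, supp j \subset U} -> depends_on U (avoid S).
Proof.
move=> sub x y xy; apply/bigcapP/bigcapP => h j jS; have := h j jS;
  rewrite !inE (A_supp (x := x) (y := y)) // => t tj;
  by apply: xy; apply: (subsetP (sub j jS)).
Qed.

Lemma avoidS (S S' : {set I}) : S \subset S' -> avoid S' \subset avoid S.
Proof.
move=> /subsetP sub; apply/subsetP => x /bigcapP h.
by apply/bigcapP => j /sub; apply: h.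
Qed.

(** The usual induction of the symmetric local lemma for the uniform measure, with denominators
    cleared: given that all events of [S] are avoided, any event has conditional probability at most
    1/(2d). Positivity follows by adding one event at a time. *)
Lemma avoid_step (S : {set I}) :
  0 < d -> 0 < #|avoid S| /\
  forall i, 2 * d * #|A i :&: avoid S| <= #|avoid S|.
Proof.
move=> d0; move: {2}#|S| (erefl #|S|) => n; elim/ltn_ind: n S => n IH S eS.
have main i : 2 * d * #|A i :&: avoid S| <= #|avoid S|.
  (* The events of [S] independent of [A i]. Conditioned on avoiding these, [A i] has probability at
     most 1/(4d), and the at most [d] remaining events of [S] remove at most half of [avoid S2],
     which costs a factor 2. *)
  pose S2 := [set j in S | [disjoint supp i & supp j]].
  have sS2 : S2 \subset S by apply/subsetP => j; rewrite inE => /andP[].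
  have indep : 4 * d * #|A i :&: avoid S2| <= #|avoid S2|.
    rewrite -(leq_pmul2r Omega_gt0) -mulnA (card_setI_indep (S := supp i)) //.
      by rewrite mulnA mulnC leq_mul2l A_small orbT.
    by apply: avoid_depends => j; rewrite inE subsets_disjoint setCK disjoint_sym
      => /andP[].
  have le1 : #|A i :&: avoid S| <= #|A i :&: avoid S2|.
    by apply: subset_leq_card; apply: setIS; apply: avoidS.
  have le2 : #|avoid S2| <= 2 * #|avoid S|.
    have [eSS|ne] := eqVneq S2 S; first by rewrite eSS; lia.
    have lt2 : #|S2| < n.
      by rewrite -eS; apply: proper_card; rewrite properEneq ne.
    have [_ IH2] := IH _ lt2 S2 erefl.
    have cover : avoid S2 \subset avoid S :|:
        \bigcup_(j in S :\: S2) (A j :&: avoid S2).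
      apply/subsetP => x xS2; rewrite inE.
      case: (boolP (x \in avoid S)) => //= /bigcapP h.
      case: (boolP [exists j in S, x \in A j]) => [/exists_inP[j jS xj]|/exists_inPn h'].
        apply/bigcupP; exists j; last by rewrite inE xj.
        rewrite inE jS andbT; apply/negP => jS2.
        by move/bigcapP: xS2 => /(_ j jS2); rewrite inE xj.
      by case: h => j /h' ?; rewrite inE.
    have h1 : \sum_(j in S :\: S2) (2 * d * #|A j :&: avoid S2|) <= d * #|avoid S2|.
      apply: (@leq_trans (\sum_(j in S :\: S2) #|avoid S2|)).
        by apply: leq_sum => j _.
      rewrite sum_nat_const leq_mul2r; apply/orP; right.
      apply: leq_trans (deg_le i); apply: subset_leq_card; apply/subsetP => j.
      by rewrite !inE; case: (j \in S) => /=; rewrite ?andbT ?andbF.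
    rewrite -big_distrr /= in h1.
    have h2 := subset_leq_card cover.
    have h3 := leq_of_leqif (leq_card_setU (avoid S) (\bigcup_(j in S :\: S2) (A j :&: avoid S2))).
    have h4 : #|\bigcup_(j in S :\: S2) (A j :&: avoid S2)| <=
       \sum_(j in S :\: S2) #|A j :&: avoid S2| by apply: card_bigcup_le.
    rewrite -mulnA [2 * _]mulnC -mulnA leq_pmul2l // in h1.
    have {h2 h3 h4} := leq_trans h2 (leq_trans h3 (leq_add (leqnn _) h4)).
    by move: h1; move: (\sum_(i in _) _) #|avoid S2| #|avoid S| => s a b; lia.
  nia.
split=> //; case: (set_0Vmem S) => [->|[j jS]].
  by rewrite /avoid big_set0 cardsT.
have lt2 : #|S :\ j| < n by rewrite -eS [X in _ < X](cardsD1 j) jS.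
have [pos /(_ j) IH2] := IH _ lt2 (S :\ j) erefl.
have sub : avoid (S :\ j) :\: (A j :&: avoid (S :\ j)) \subset avoid S.
  apply/subsetP => x; rewrite !inE negb_and => /andP[h1 h2].
  rewrite h2 orbF in h1; apply/bigcapP => i iS; have [->|ne] := eqVneq i j.
    by rewrite inE.
  by move/bigcapP: h2 => /(_ i); rewrite !inE ne iS; apply.
have := subset_leq_card sub; rewrite cardsD.
have : avoid (S :\ j) :&: (A j :&: avoid (S :\ j)) = A j :&: avoid (S :\ j).
  by apply/setIidPr; apply: subsetIr.
move=> ->; nia.
Qed.

Lemma local_lemma : 0 < d -> exists x : {ffun T -> L}, forall i, x \notin A i.
Proof.
move=> d0; have [/card_gt0P[x /bigcapP h] _] := avoid_step setT d0.
by exists x => i; have := h i (in_setT i); rewrite inE.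
Qed.

End LocalLemma.

(** * Edge colouring of bipartite graphs with a power of two colours *)

(* Two fixed-point-free involutions [a], [b] never put [x] and [a x] in the same
   orbit of [a \o b], and [b] maps an orbit to its [a]-image; so the orbits come
   in pairs that can be given opposite colours. *)
Lemma involutions_2colour (E : finType) (a b : E -> E) :
  involutive a -> involutive b -> (forall x, a x != x) -> (forall x, b x != x) ->
  exists f : E -> bool, (forall x, f (a x) = ~~ f x) /\ (forall x, f (b x) = ~~ f x).
Proof.
move=> aK bK fa fb; pose g x := a (b x).
have g_inj : injective g by move=> x y /(inv_inj aK) /(inv_inj bK).
have symg : connect_sym (frel g) by apply: fconnect_sym.
have gag x : g (a (g x)) = a x by rewrite /g aK bK.
have gagn n x : iter n g (a (iter n g x)) = a x.
  by elim: n x => //= n IH x; rewrite -iterS iterSr gag IH.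
(* If [a x] is the [k]-th iterate of [g] at [x], then the iterate halfway is a fixed point of [a]
   when [k] is even and of [b] when [k] is odd. *)
have sep x : ~~ fconnect g x (a x).
  apply/negP => /iter_findex; move: (findex _ _ _) => k ek.
  have [j ej] : exists j, k = j.*2 \/ k = j.*2.+1.
    by exists k./2; rewrite -[k in k = _ \/ _]odd_double_half -[k in _ \/ k = _]odd_double_half;
      case: odd; [right|left].
  have g_iter_inj n : injective (iter n g).
    by elim: n => // n IH y z /= /g_inj /IH.
  case: ej => ej; rewrite {}ej in ek.
    have := gagn j x; rewrite -ek -addnn iterD => /g_iter_inj h.
    by have := fa (iter j g x); rewrite h eqxx.
  have := gagn j x; rewrite -ek -addnn -addSn iterD.
  rewrite iterSr => /g_iter_inj /(inv_inj aK) h.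
  by have := fb (iter j g x); rewrite -h eqxx.
have cong x y : fconnect g x y -> fconnect g (a x) (a y).
  move=> /iter_findex <-; move: (findex _ _ _) => k.
  rewrite symg -[X in fconnect _ _ X](gagn k x); exact: fconnect_iter.
pose r x := froot g x.
have rP x y : fconnect g x y -> r x = r y by move/(rootP symg).
have rbx x : r (b x) = r (a x).
  apply: rP; have := cong _ _ (fconnect1 g x).
  by rewrite /g aK symg.
have rab x y : r x = r y -> r (a x) = r (a y).
  by move/(rootP symg)/cong; apply: rP.
have ne x : r x != r (a x).
  by apply/eqP => /(rootP symg) h; have := sep x; rewrite h.
(* The colour tells which of the two paired orbits, compared by the rank of their roots, contains
   [x]. *)
exists (fun x => enum_rank (r x) < enum_rank (r (a x))).
have fax x : (enum_rank (r (a x)) < enum_rank (r x)) =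
    ~~ (enum_rank (r x) < enum_rank (r (a x))).
  rewrite -leqNgt [RHS]leq_eqVlt; case: eqP => // /val_inj /enum_rank_inj h.
  by have := ne x; rewrite h eqxx.
split=> x; first by rewrite aK fax.
by rewrite (rab (b x) (a x)) ?rbx // aK fax.
Qed.

(** Fixed points disappear on two copies of [E]: a lifted involution exchanges the two copies of
    each fixed point and acts inside a copy elsewhere. The colouring is then read on one copy. *)
Lemma involutions_2colour_moved (E : finType) (a b : E -> E) :
  involutive a -> involutive b -> exists f : E -> bool,
  (forall x, a x != x -> f (a x) = ~~ f x) /\ (forall x, b x != x -> f (b x) = ~~ f x).
Proof.
move=> aK bK.
pose up (c : E -> E) (p : E * bool) :=
  if c p.1 == p.1 then (p.1, ~~ p.2) else (c p.1, p.2).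
have upK c : involutive c -> involutive (up c).
  move=> cK [x s]; rewrite /up /=; case: (eqVneq (c x) x) => /= [->|h].
    by rewrite eqxx negbK.
  by rewrite cK eq_sym (negbTE h).
have upN c : forall p, up c p != p.
  case=> x s; rewrite /up /=; case: (eqVneq (c x) x) => /= [_|h].
    by apply/eqP => -[]; case: s.
  by apply/eqP => -[] /eqP; rewrite (negbTE h).
have [f [fa fb]] := involutions_2colour (upK a aK) (upK b bK) (upN a) (upN b).
exists (fun x => f (x, true)); split=> x /negbTE h.
  by rewrite -fa /up /= h.
by rewrite -fb /up /= h.
Qed.

Definition fibre (E X : finType) (l : E -> X) x := [set e | l e == x].

(** Among the involutions preserving the fibres of [l], one with fewest fixed points works: two
    fixed points in the same fibre could be exchanged with each other. *)
Lemma fibre_pairing (E X : finType) (l : E -> X) :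
  exists a : {ffun E -> E}, [/\ involutive a, forall x, l (a x) = l x &
    forall x y, l x = l y -> a x = x -> a y = y -> x = y].
Proof.
pose P (a : {ffun E -> E}) := [forall x, (a (a x) == x) && (l (a x) == l x)].
have P1 : P [ffun x => x] by apply/forallP => x; rewrite !ffunE !eqxx.
pose nfix (a : {ffun E -> E}) := #|[set x | a x == x]|.
case: (arg_minnP nfix P1) => a /forallP Pa mina.
have aK : involutive a by move=> x; have /andP[/eqP] := Pa x.
have al x : l (a x) = l x by have /andP[_ /eqP] := Pa x.
exists a; split=> // x y lxy ax ay; apply/eqP/negPn/negP => nexy.
pose a' : {ffun E -> E} := [ffun z => if z == x then y else if z == y then x else a z].
have Pa' : P a'.
  apply/forallP => z; rewrite !ffunE.
  have [->|nzx] := eqVneq z x; first by rewrite (eq_sym y) (negbTE nexy) ?eqxx lxy ?eqxx.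
  have [->|nzy] := eqVneq z y; first by rewrite eqxx lxy !eqxx.
  rewrite -{1}ax (inj_eq (inv_inj aK)) (negbTE nzx).
  by rewrite -{1}ay (inj_eq (inv_inj aK)) (negbTE nzy) aK al !eqxx.
have := mina a' Pa'; rewrite leqNgt => /negP; apply.
apply: proper_card; apply/properP; split; last first.
  by exists x; rewrite inE ?ax ?eqxx // ffunE eqxx eq_sym.
apply/subsetP => z; rewrite !inE ffunE.
have [->|nzx] := eqVneq z x; first by rewrite ax eqxx.
by have [->|nzy] := eqVneq z y; first by rewrite ay eqxx.
Qed.

(** [E] is the edge set of a bipartite multigraph with end maps [l] and [r]. Pair up the edges at
    each vertex, leaving at most one unpaired, and give paired edges opposite colours: this is an
    Euler splitting without walks. *)
Lemma balanced_split (E X Y : finType) (l : E -> X) (r : E -> Y) :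
  exists f : E -> bool,
    (forall x s, 2 * #|[set e | (l e == x) && (f e == s)]| <= #|fibre l x|.+1) /\
    (forall y s, 2 * #|[set e | (r e == y) && (f e == s)]| <= #|fibre r y|.+1).
Proof.
have [a [aK al a1]] := fibre_pairing l; have [b [bK br b1]] := fibre_pairing r.
have [f [fa fb]] := involutions_2colour_moved aK bK; exists f.
suff main (Z : finType) (g : E -> Z) (c : E -> E) : involutive c ->
    (forall x, g (c x) = g x) ->
    (forall x y, g x = g y -> c x = x -> c y = y -> x = y) ->
    (forall x, c x != x -> f (c x) = ~~ f x) ->
    forall z s, 2 * #|[set e | (g e == z) && (f e == s)]| <= #|fibre g z|.+1.
  by split; [apply: (main _ l a)|apply: (main _ r b)].
move=> cK cg c1 fc z s.
pose A t := [set e | (g e == z) && (f e == t)].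
have cardF : #|fibre g z| = #|A s| + #|A (~~ s)|.
  rewrite -cardsUI (_ : A s :&: A (~~ s) = set0) ?cards0 ?addn0.
    apply: eq_card => e; rewrite !inE -andb_orr.
    by case: (f e) (s) => -[] //=; rewrite andbT.
  by apply/setP => e; rewrite !inE; case: (f e) (s) => -[] //=; rewrite ?andbF.
pose Fx := [set e in A s | c e == e].
have le1 : #|Fx| <= 1.
  rewrite leqNgt; apply/negP => /card_gt1P[x [y []]].
  rewrite !inE => /andP[/andP[/eqP gx _] /eqP cx] /andP[/andP[/eqP gy _] /eqP cy].
  by rewrite (c1 x y) ?eqxx // gx gy.
have le2 : #|A s :\: Fx| <= #|A (~~ s)|.
  rewrite -(card_imset _ (inv_inj cK)); apply: subset_leq_card.
  apply/subsetP => _ /imsetP[x + ->]; rewrite !inE negb_and.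
  case/andP => /orP[/negbTE->//|h] /andP[/eqP gx /eqP fx].
  by rewrite cg gx fc // fx !eqxx.
have := cardsID Fx (A s).
have -> : A s :&: Fx = Fx by apply/setIidPr/subsetP => e; rewrite inE => /andP[].
rewrite -/(A s) cardF; lia.
Qed.

(** Each splitting halves the maximal degree and contributes one binary digit of the colour. Pairing
    an end with the digit makes both halves one multigraph, so a single induction hypothesis colours
    them together. The [+ 1] in the splitting bound is harmless because [2 ^ k.+1] is even. *)
Lemma bipartite_edge_colouring (k : nat) (E X Y : finType) (l : E -> X) (r : E -> Y) :
  (forall x, #|fibre l x| <= 2 ^ k) -> (forall y, #|fibre r y| <= 2 ^ k) ->
  exists f : E -> nat, [/\ forall e, f e < 2 ^ k,
    forall e e', l e = l e' -> f e = f e' -> e = e' &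
    forall e e', r e = r e' -> f e = f e' -> e = e'].
Proof.
elim: k X Y l r => [|k IH] X Y l r hl hr.
  have aux (Z : finType) (g : E -> Z) : (forall z, #|fibre g z| <= 1) ->
      forall e e', g e = g e' -> e = e'.
    move=> h e e' ee'; apply/eqP/negPn/negP => ne.
    have := h (g e); rewrite leqNgt => /negP; apply; apply/card_gt1P.
    by exists e, e'; rewrite !inE ee' eqxx.
  by exists (fun=> 0); split=> // e e' h _; [apply: (aux _ l)|apply: (aux _ r)].
have [g [gl gr]] := balanced_split l r.
have E2 : 2 ^ k.+1 = 2 * 2 ^ k := expnS 2 k.
pose l' e := (l e, g e); pose r' e := (r e, g e).
have hl' x : #|fibre l' x| <= 2 ^ k.
  case: x => x s; have := hl x; have := gl x s.
  rewrite (_ : #|fibre l' (x, s)| = #|[set e | (l e == x) && (g e == s)]|); last first.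
    by apply: eq_card => e; rewrite !inE.
  by rewrite E2; move: #|_| #|_| (2 ^ k) => u v w; lia.
have hr' x : #|fibre r' x| <= 2 ^ k.
  case: x => x s; have := hr x; have := gr x s.
  rewrite (_ : #|fibre r' (x, s)| = #|[set e | (r e == x) && (g e == s)]|); last first.
    by apply: eq_card => e; rewrite !inE.
  by rewrite E2; move: #|_| #|_| (2 ^ k) => u v w; lia.
have [f [fk fl fr]] := IH _ _ l' r' hl' hr'.
have split_eq e e' : f e + g e * 2 ^ k = f e' + g e' * 2 ^ k -> g e = g e' /\ f e = f e'.
  by have := fk e; have := fk e'; case: (g e); case: (g e') => /=; move: (2 ^ k); lia.
exists (fun e => f e + g e * 2 ^ k); split.
- by move=> e; have := fk e; rewrite E2; case: (g e) => /=; move: (2 ^ k); lia.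
- by move=> e e' le /split_eq[ge fe]; apply: fl; rewrite // /l' le ge.
- by move=> e e' le /split_eq[ge fe]; apply: fr; rewrite // /r' le ge.
Qed.

(** * Concentration of local sums *)

HB.instance Definition _ := Monoid.isComLaw.Build R 0%R Rplus
  (fun x y z => esym (Rplus_assoc x y z)) Rplus_comm Rplus_0_l.
HB.instance Definition _ := Monoid.isComLaw.Build R 1%R Rmult
  (fun x y z => esym (Rmult_assoc x y z)) Rmult_comm Rmult_1_l.
HB.instance Definition _ := Monoid.isMulLaw.Build R 0%R Rmult Rmult_0_l Rmult_0_r.
HB.instance Definition _ := Monoid.isAddLaw.Build R Rmult Rplus
  (fun x y z => Rmult_plus_distr_r x y z) (fun x y z => Rmult_plus_distr_l x y z).

Lemma INR_addn m n : INR (m + n) = (INR m + INR n)%R.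
Proof. by rewrite -plus_INR. Qed.

Lemma INR_muln m n : INR (m * n) = (INR m * INR n)%R.
Proof. by rewrite -mult_INR. Qed.

Lemma INR_leq m n : m <= n -> (INR m <= INR n)%R.
Proof. by move=> /leP /le_INR. Qed.

Lemma leq_INR m n : (INR m <= INR n)%R -> m <= n.
Proof. by move=> /INR_le /leP. Qed.

Lemma INR_ltn0 n : 0 < n -> (0 < INR n)%R.
Proof. by move=> /ltP /lt_0_INR. Qed.

Lemma INR_sum (I : finType) (P : pred I) (F : I -> nat) :
  INR (\sum_(i | P i) F i) = \big[Rplus/0%R]_(i | P i) INR (F i).
Proof. exact: (big_morph INR INR_addn). Qed.

Lemma exp_sum (I : finType) (P : pred I) (F : I -> R) :
  exp (\big[Rplus/0%R]_(i | P i) F i) = \big[Rmult/1%R]_(i | P i) exp (F i).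
Proof. exact: (big_morph exp exp_plus exp_0). Qed.

Lemma Rsum_le (I : finType) (P : pred I) (F G : I -> R) :
  (forall i, P i -> (F i <= G i)%R) ->
  (\big[Rplus/0%R]_(i | P i) F i <= \big[Rplus/0%R]_(i | P i) G i)%R.
Proof.
move=> h; elim/big_ind2: _ => //; first exact: Rle_refl.
by move=> a b c e; apply: Rplus_le_compat.
Qed.

Lemma Rsum_const (I : finType) (P : pred I) (c : R) :
  \big[Rplus/0%R]_(i | P i) c = (INR #|P| * c)%R.
Proof.
rewrite big_const; elim: #|_| => [|n IH]; first by rewrite /= Rmult_0_l.
by rewrite iterS IH S_INR; lra.
Qed.

Lemma Rsum_constT (I : finType) (c : R) : \big[Rplus/0%R]_(i : I) c = (INR #|I| * c)%R.
Proof. exact: Rsum_const. Qed.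

Lemma Rprod_le (I : finType) (P : pred I) (F G : I -> R) :
  (forall i, P i -> (0 <= F i <= G i)%R) ->
  (0 <= \big[Rmult/1%R]_(i | P i) F i <= \big[Rmult/1%R]_(i | P i) G i)%R.
Proof.
move=> h; elim/big_ind2: _ => //; first lra.
by move=> a b c e [? ?] [? ?]; split; [apply: Rmult_le_pos|apply: Rmult_le_compat].
Qed.

(** From [exp (- z) >= 1 - z] one gets [exp z * (1 - z) <= 1], while [(1 + z + 2 z^2) (1 - z) = 1 +
    z^2 (1 - 2 z)] is at least 1. *)
Lemma exp_le_quadratic z : (z <= / 2)%R -> (exp z <= 1 + z + 2 * z ^ 2)%R.
Proof.
move=> hz; have h := exp_ineq1_le (- z).
have p := exp_pos z; have e : (exp z * exp (- z) = 1)%R.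
  by rewrite -exp_plus Rplus_opp_r exp_0.
have h1 : (exp z * (1 - z) <= 1)%R by rewrite -e; apply: Rmult_le_compat_l; lra.
have h2 : (1 <= (1 + z + 2 * z ^ 2) * (1 - z))%R by nra.
apply: (Rmult_le_reg_r (1 - z)); lra.
Qed.

(** The labellings whose weight exceeds its mean under uniform labels by more than [t]; multiplying
    by [#|L|] keeps the mean an integer. *)
Definition overshoot (T L : finType) (P : pred T) (w : T -> L -> nat) (t : nat) :
  {set {ffun T -> L}} :=
  [set x : {ffun T -> L} | \sum_(u | P u) \sum_a w u a + #|L| * t < #|L| * \sum_(u | P u) w u (x u)].

(** Exponential moments: the centred weights divided by [M] lie in [-1, 1], so each of the at most
    [Dl] factors contributes at most [exp (2 s^2)], against [exp (s D)] on the bad labellings. *)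
Lemma chernoff_count (T L : finType) (P : pred T) (w : T -> L -> nat) (M D Dl : nat) :
  #|P| <= Dl -> 0 < Dl -> D <= 2 * Dl -> 0 < #|L| ->
  (forall u a, w u a <= M) ->
  (INR #|overshoot P w (M * D)| * exp (INR D ^ 2 / (8 * INR Dl))
   <= INR #|{ffun T -> L}|)%R.
Proof.
move=> cardP Dl0 DDl L0 wM; set Bad := overshoot _ _ _.
have [M0|M0] := posnP M.
  rewrite (_ : Bad = set0) ?cards0 /=; first by rewrite Rmult_0_l; apply: pos_INR.
  apply/setP => x; rewrite !inE; apply/negbTE; rewrite -leqNgt big1 ?muln0 //.
  by move=> u _; apply/eqP; rewrite -leqn0 -M0.
have rDl := INR_ltn0 Dl0; have rL := INR_ltn0 L0; have rM := INR_ltn0 M0.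
have rD := pos_INR D.
(* The minimiser of [2 s^2 Dl - s D], with minimum [- D^2 / (8 Dl)]. The hypothesis [D <= 2 * Dl]
   gives [s <= 1/2], as the quadratic bound requires. *)
pose s := (INR D / (4 * INR Dl))%R.
have s0 : (0 <= s)%R by apply: Rmult_le_pos => //; apply/Rlt_le/Rinv_0_lt_compat; lra.
have s1 : (s <= / 2)%R.
  apply: (Rmult_le_reg_r (4 * INR Dl)); first lra.
  have := INR_leq DDl; rewrite INR_muln (_ : INR 2 = 2%R) // => h.
  have -> : (s * (4 * INR Dl) = INR D)%R by rewrite /s; field; lra.
  lra.
pose mean u := (INR (\sum_a w u a) / INR #|L|)%R.
have mean0M u : (0 <= mean u <= INR M)%R.
  split; first by apply: Rmult_le_pos (pos_INR _) _; apply/Rlt_le/Rinv_0_lt_compat.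
  apply: (Rmult_le_reg_r (INR #|L|)) => //.
  rewrite /mean /Rdiv Rmult_assoc Rinv_l; last lra.
  rewrite Rmult_1_r -INR_muln; apply: INR_leq.
  by rewrite mulnC -sum_nat_const; apply: leq_sum.
pose g u a := (if P u then s * ((INR (w u a) - mean u) / INR M) else 0)%R.
have g_sum u : \big[Rplus/0%R]_a g u a = 0%R.
  rewrite /g; case: (P u); last by rewrite big1.
  rewrite -big_distrr -big_distrl /= (_ : \big[Rplus/0%R]_a _ = 0)%R; first lra.
  rewrite (big_split Rplus) /= Rsum_constT -INR_sum /mean; field; lra.
have g_le u a : (- s <= g u a <= s)%R.
  rewrite /g; case: (P u); last lra.
  have h1 := INR_leq (wM u a); have h2 := pos_INR (w u a); have [h3 h4] := mean0M u.
  have h5 : (((INR (w u a) - mean u) / INR M) * INR M = INR (w u a) - mean u)%R.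
    by field; lra.
  move: h5; set z := (_ / _)%R => h5.
  have [h6 h7] : (-1 <= z /\ z <= 1)%R by split; nra.
  nra.
have inner u : (0 <= \big[Rplus/0%R]_a exp (g u a) <=
    INR #|L| * exp (if P u then 2 * s ^ 2 else 0))%R.
  split.
    elim/big_ind: _ => *; first lra; first by apply: Rplus_le_le_0_compat.
    exact/Rlt_le/exp_pos.
  pose q : R := if P u then (s ^ 2)%R else 0%R.
  apply: (@Rle_trans _ (\big[Rplus/0%R]_a (1 + g u a + 2 * q)%R)); rewrite /q.
    apply: Rsum_le => a _; have := g_le u a; rewrite /g; case: (P u) => h; last first.
      by rewrite exp_0; lra.
    apply: Rle_trans (exp_le_quadratic _) _; first lra.
    apply: Rplus_le_compat_l; apply: Rmult_le_compat_l; first lra.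
    nra.
  rewrite !(big_split Rplus) /= g_sum !Rsum_constT.
  rewrite Rplus_0_r -Rmult_plus_distr_l.
  apply: Rmult_le_compat_l; first lra.
  by case: (P u); apply: Rle_trans (exp_ineq1_le _); lra.
have bad x : x \in Bad -> (s * INR D <= \big[Rplus/0%R]_u g u (x u))%R.
  rewrite inE => /ltnW /INR_leq; rewrite INR_addn !INR_muln !INR_sum => hb.
  rewrite /g -big_mkcond /= -big_distrr -big_distrl /=.
  apply: Rmult_le_compat_l => //.
  apply: (Rmult_le_reg_r (INR M)) => //.
  rewrite Rmult_assoc Rinv_l; last lra.
  rewrite Rmult_1_r (big_split Rplus) /=.
  have -> : \big[Rplus/0%R]_(u | P u) (- mean u)%R =
      (- (\big[Rplus/0%R]_(u | P u) INR (\sum_a w u a)) / INR #|L|)%R.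
    rewrite -(big_morph Ropp Ropp_plus_distr Ropp_0) /Rdiv.
    by rewrite Ropp_mult_distr_l_reverse -big_distrl.
  by apply: (Rmult_le_reg_l (INR #|L|)) => //; field_simplify; lra.
have total : (\big[Rplus/0%R]_(x : {ffun T -> L}) exp (\big[Rplus/0%R]_u g u (x u)) <=
    INR #|{ffun T -> L}| * exp (INR Dl * (2 * s ^ 2)))%R.
  under eq_bigr => x _ do rewrite exp_sum.
  (* Independence of the labels: a sum over functions of products is a product of sums. *)
  rewrite -(bigA_distr_bigA (fun u a => exp (g u a))) /=.
  apply: Rle_trans (proj2 (Rprod_le (fun u _ => inner u))) _.
  rewrite (big_split Rmult) /= -exp_sum -big_mkcond Rsum_const.
  rewrite (_ : \big[Rmult/1%R]_(u : T) INR #|L| = INR #|{ffun T -> L}|); last first.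
    by rewrite card_ffun -prod_nat_const (big_morph INR INR_muln (erefl : INR 1 = 1%R)).
  apply: Rmult_le_compat_l; first exact: pos_INR.
  have h := INR_leq cardP.
  have [h0|h0] : (INR #|P| * (2 * s ^ 2) < INR Dl * (2 * s ^ 2) \/
     INR #|P| * (2 * s ^ 2) = INR Dl * (2 * s ^ 2))%R by nra.
    exact/Rlt_le/exp_increasing.
  rewrite h0; exact: Rle_refl.
have lower : (INR #|Bad| * exp (s * INR D) <=
    \big[Rplus/0%R]_(x : {ffun T -> L}) exp (\big[Rplus/0%R]_u g u (x u)))%R.
  have -> : (INR #|Bad| * exp (s * INR D) =
      \big[Rplus/0%R]_(x | x \in Bad) exp (s * INR D))%R by rewrite Rsum_const.
  rewrite big_mkcond /=; apply: Rsum_le => x _.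
  case: (boolP (x \in Bad)) => [/bad h|_]; last exact/Rlt_le/exp_pos.
  have [h0|->] : (s * INR D < \big[Rplus/0%R]_u g u (x u) \/
     s * INR D = \big[Rplus/0%R]_u g u (x u))%R by lra.
    exact/Rlt_le/exp_increasing.
  lra.
have := Rle_trans _ _ _ lower total.
set q := (INR D ^ 2 / (8 * INR Dl))%R.
have -> : (s * INR D = q + q)%R by rewrite /s /q; field; lra.
have -> : (INR Dl * (2 * s ^ 2) = q)%R by rewrite /s /q; field; lra.
rewrite exp_plus -Rmult_assoc => h.
by apply: (Rmult_le_reg_r (exp q)) => //; apply: exp_pos.
Qed.

(* Lower tails are upper tails of the complementary weights [M j - w]. *)
Lemma local_discrepancy (T L J : finType) (e : rel T) (w : T -> J -> T -> L -> nat)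
    (M : J -> nat) (D Dl : nat) :
  symmetric e -> (forall v, deg e v <= Dl) -> 0 < Dl -> D <= 2 * Dl -> 0 < #|L| ->
  (forall v j u a, w v j u a <= M j) ->
  (INR (4 * Dl ^ 2 * #|J|) <= exp (INR D ^ 2 / (8 * INR Dl)))%R ->
  exists x : T -> L, forall v j,
    #|L| * \sum_(u | e v u) w v j u (x u) <=
    \sum_(u | e v u) \sum_a w v j u a + #|L| * (M j * D).
Proof.
move=> esym degD Dl0 DDl L0 wM large.
(* One bad event per vertex, gathering all [j]. It depends only on the labels of the neighbours of
   [v], so it meets at most [Dl ^ 2] supports; the hypothesis on [exp] is [4 * Dl ^ 2] times the
   union bound over [J]. *)
pose A v := \bigcup_j overshoot (e v) (w v j) (M j * D).
pose N v := [set u | e v u].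
have Omega0 : 0 < #|{ffun T -> L}| by rewrite card_ffun expn_gt0 L0.
have [x hx] : exists x : {ffun T -> L}, forall v, x \notin A v.
  apply: (@local_lemma _ _ _ A N (Dl ^ 2)) => //; last by rewrite expn_gt0 Dl0.
  - move=> v x y xy; apply/bigcupP/bigcupP => -[j _]; rewrite inE => h;
      exists j => //; rewrite inE; move: h; congr (_ < _ * _);
      by apply: eq_bigr => u vu; rewrite xy // inE.
  - move=> v; apply: (@leq_trans #|\bigcup_(u in N v) N u|).
      apply: subset_leq_card; apply/subsetP => z; rewrite inE => /pred0Pn[u /=].
      rewrite !inE => /andP[vu zu]; apply/bigcupP; exists u; first by rewrite inE.
      by rewrite inE esym.
    apply: leq_trans (card_bigcup_le _ _) _.
    apply: (@leq_trans (\sum_(u in N v) Dl)); first by apply: leq_sum => u _; apply: degD.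
    by rewrite sum_nat_const -mulnn leq_mul2r degD orbT.
  - move=> v; apply: leq_INR.
    apply: (@Rle_trans _ (INR (4 * Dl ^ 2) *
        \big[Rplus/0%R]_(j : J) INR #|overshoot (e v) (w v j) (M j * D)|)%R).
      rewrite INR_muln -INR_sum; apply: Rmult_le_compat_l; first exact: pos_INR.
      exact/INR_leq/card_bigcup_le.
    set q := exp _ in large; have q0 : (0 < q)%R by apply: exp_pos.
    apply: (Rmult_le_reg_r q) => //.
    rewrite Rmult_assoc big_distrl /=.
    apply: (@Rle_trans _ (INR (4 * Dl ^ 2) * (INR #|J| * INR #|{ffun T -> L}|))%R).
      apply: Rmult_le_compat_l; first exact: pos_INR.
      rewrite -Rsum_constT.
      apply: Rsum_le => j _; apply: chernoff_count => //.
      by have := degD v; rewrite /deg cardsE.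
    rewrite -Rmult_assoc -INR_muln Rmult_comm; apply: Rmult_le_compat_l => //.
    exact: pos_INR.
exists x => v j; rewrite leqNgt; apply: contra (hx v) => h.
by apply/bigcupP; exists j => //; rewrite inE.
Qed.

(** * Greedy colourings that separate sums *)

Lemma set2_injr (T : finType) (u v w : T) :
  u != v -> [set u; v] = [set u; w] -> v = w.
Proof.
move=> uv /setP/(_ v); rewrite !inE eqxx orbT eq_sym (negbTE uv) /= => /esym.
by move/eqP.
Qed.

(* Edges of [H] are coloured one at a time in a fixed order. The sum at a vertex is
   settled by its last edge, and since [F] and [H] are disjoint the two ends of an
   [F]-edge have different last edges, so the later one can separate the sums. *)
Lemma greedy_edge_colouring (T : finType) (H F : rel T) (base : T -> nat) (h B k : nat) :
  symmetric H -> irreflexive H -> symmetric F -> irreflexive F ->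
  (forall v, deg H v <= h) -> (forall v, deg F v <= B) ->
  (forall u v, F u v -> ~~ H u v) -> (forall u v, F u v -> exists w, H u w) ->
  2 * h + 2 * B < k ->
  exists c : T -> T -> nat, [/\ forall u v, c u v = c v u, forall u v, c u v < k,
    forall u v w, H u v -> H u w -> v <> w -> c u v <> c u w &
    forall u v, F u v -> base u + \sum_(w | H u w) c u w <>
                         base v + \sum_(w | H v w) c v w].
Proof.
move=> Hsym Hirr Fsym Firr degH degF FH Fex hk.
(* Edges are two-element sets, so that a colour is symmetric by construction. Greedy choice runs
   over all sets of vertices, and those of another size carry no constraint. *)
pose item (x w : T) := [set x; w].
pose rk (X : {set T}) : nat := enum_rank X.
pose last_at x (X : {set T}) := [forall w, H x w ==> (item x w == X) || (rk (item x w) < rk X)].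
pose done_before v (X : {set T}) := [forall w, H v w ==> (rk (item v w) < rk X)].
pose others (q : {set T} -> nat) x (X : {set T}) := \sum_(w | H x w && (item x w != X)) q (item x w).
pose total (q : {set T} -> nat) v := \sum_(w | H v w) q (item v w).
(* Constraints coming from the end [x]: colours of earlier edges at [x], and, when [X] is the last
   edge at [x], the values that would equate its sum with that of an [F]-neighbour whose edges all
   come earlier. Whenever the sums agree, the truncated subtraction is exact. *)
pose forbv q (X : {set T}) x :=
  [seq q (item x w) | w <- enum [set w | H x w & rk (item x w) < rk X]] ++
  [seq base v + total q v - (base x + others q x X) |
    v <- enum [set v | [&& last_at x X, F x v & done_before v X]]].
pose forb q (X : {set T}) := if #|X| == 2 then flatten [seq forbv q X x | x <- enum X] else [::].
have [q hq] : exists q : {set T} -> nat, forall X, q X < k /\ q X \notin forb q X.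
  apply: greedy_choice => [q q' X eqq|q X]; last first.
    rewrite /forb; case: eqP => [|_]; last by rewrite /= (leq_ltn_trans _ hk).
    have szv x : size (forbv q X x) <= h + B.
      rewrite size_cat !size_map -!cardE leq_add //.
        apply: leq_trans (degH x); apply: subset_leq_card.
        by apply/subsetP => w; rewrite !inE => /andP[].
      apply: leq_trans (degF x); apply: subset_leq_card.
      by apply/subsetP => w; rewrite !inE => /and3P[].
    rewrite cardE; case: (enum X) => [|a [|b []]] // _.
    rewrite -[size _]/(size (forbv q X a ++ (forbv q X b ++ [::]))) cats0 size_cat.
    by apply: leq_ltn_trans (leq_add (szv a) (szv b)) _; lia.
  rewrite /forb; case: ifP => // _; congr flatten; apply: eq_map => x.
  congr (_ ++ _); apply/eq_in_map => w; rewrite mem_enum !inE.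
    by case/andP => _; apply: eqq.
  case/and3P => /forallP lastx _ /forallP donew.
  have -> : total q w = total q' w.
    by apply: eq_bigr => z wz; apply: eqq; move: (donew z); rewrite wz.
  have -> // : others q x X = others q' x X.
  apply: eq_bigr => z /andP[xz ne]; apply: eqq.
  by move: (lastx z); rewrite xz (negbTE ne).
exists (fun u v => q (item u v)).
have forbE u v z : H u v -> z \in forbv q (item u v) u -> q (item u v) <> z.
  move=> uv zin qz; have [_ /negP] := hq (item u v); apply.
  have nuv : u != v by apply: contraTneq uv => ->; rewrite Hirr.
  rewrite /forb cards2 nuv; apply/flattenP; exists (forbv q (item u v) u).
    by apply/mapP; exists u; rewrite // mem_enum !inE eqxx.
  by rewrite qz.
have Hneq u v : H u v -> u != v by move=> uv; apply: contraTneq uv => ->; rewrite Hirr.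
split.
- by move=> u v; rewrite /item setUC.
- by move=> u v; have [] := hq (item u v).
- have main u v w : H u v -> H u w -> rk (item u w) < rk (item u v) ->
      q (item u v) <> q (item u w).
    move=> uv uw lt; apply: forbE => //; rewrite mem_cat; apply/orP; left.
    by apply/mapP; exists w; rewrite // mem_enum inE uw.
  move=> u v w uv uw vw; have [lt|lt|e] := ltngtP (rk (item u v)) (rk (item u w)).
  + by move=> e; apply: (main u w v).
  + exact: main.
  + by case: vw; apply: set2_injr (Hneq _ _ uv) _; apply: enum_rank_inj (val_inj e).
- pose ismax u w := H u w /\ forall w', H u w' -> rk (item u w') <= rk (item u w).
  have maxex u v : F u v -> exists w, ismax u w.
    move=> /Fex[w0 uw0].
    case: (@arg_maxnP _ w0 (H u) (fun w => rk (item u w))) => // w uw hw.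
    by exists w.
  have main u v wu wv : F u v -> ismax u wu -> ismax v wv ->
      rk (item v wv) < rk (item u wu) ->
      base u + total q u <> base v + total q v.
    move=> Fuv [uwu mu] [vwv mv] lt.
    have -> : total q u = q (item u wu) + others q u (item u wu).
      rewrite /total (bigD1 wu) //=; congr (_ + _); apply: eq_bigl => w.
      case: (boolP (H u w)) => //= uw; congr (~~ _).
      apply/eqP/eqP => [->//|e]; apply: set2_injr e.
      exact: Hneq.
    move=> e; apply: (forbE _ _ _ uwu _ (erefl _)).
    rewrite mem_cat; apply/orP; right; apply/mapP; exists v.
      rewrite mem_enum !inE Fuv; apply/andP; split.
        apply/forallP => w; apply/implyP => uw; case: eqP => //= ne.
        rewrite ltn_neqAle mu // andbT; apply/eqP => e'; apply: ne.
        exact: enum_rank_inj (val_inj e').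
      apply/forallP => w; apply/implyP => vw; apply: leq_ltn_trans lt; exact: mv.
    rewrite -e; lia.
  move=> u v Fuv.
  have Fvu : F v u by rewrite Fsym.
  have [wu mu] := maxex _ _ Fuv; have [wv mv] := maxex _ _ Fvu.
  have [lt|lt|e] := ltngtP (rk (item u wu)) (rk (item v wv)).
  + by move=> e; apply: (main v u wv wu).
  + exact: (main u v wu wv).
  + have {}e : item u wu = item v wv by apply: enum_rank_inj (val_inj e).
    have : u \in item v wv by rewrite -e !inE eqxx.
    rewrite !inE => /orP[/eqP ev|/eqP ev]; first by rewrite ev Firr in Fuv.
    by have := FH _ _ Fuv; rewrite Hsym ev; case: mv => ->.
Qed.

Lemma proper_edge_colouring (T : finType) (H : rel T) (h : nat) :
  symmetric H -> irreflexive H -> (forall v, deg H v <= h) ->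
  exists c : T -> T -> nat, [/\ forall u v, c u v = c v u,
    forall u v, c u v < (2 * h).+1 &
    forall u v w, H u v -> H u w -> v <> w -> c u v <> c u w].
Proof.
move=> Hsym Hirr degH.
pose F : rel T := fun _ _ => false.
have degF v : deg F v <= 0.
  by rewrite /deg (_ : finset _ = set0) ?cards0 //; apply/setP => u; rewrite !inE.
have lt : 2 * h + 2 * 0 < (2 * h).+1 by rewrite muln0 addn0.
have [//|//|//|//|c [? ? ? _]] :=
  @greedy_edge_colouring T H F (fun=> 0) h 0 (2 * h).+1 Hsym Hirr _ _ degH degF _ _ lt.
by exists c.
Qed.

Lemma proper_vertex_colouring (T : finType) (e : rel T) (d : nat) :
  symmetric e -> irreflexive e -> (forall v, deg e v <= d) ->
  exists c : T -> nat, (forall v, c v < d.+1) /\ (forall u v, e u v -> c u <> c v).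
Proof.
move=> esym eirr dege.
pose forb (q : T -> nat) v := [seq q u | u <- enum [set u | e v u & enum_rank u < enum_rank v]].
have [c hc] : exists c : T -> nat, forall v, c v < d.+1 /\ c v \notin forb c v.
  apply: greedy_choice => [q q' v eqq|q v].
    by apply/eq_in_map => u; rewrite mem_enum inE => /andP[_]; apply: eqq.
  rewrite size_map -cardE ltnS; apply: leq_trans (dege v).
  by apply: subset_leq_card; apply/subsetP => u; rewrite !inE => /andP[].
exists c; split=> [v|]; first by have [] := hc v.
have main u v : e u v -> enum_rank u < enum_rank v -> c u <> c v.
  move=> uv lt euv; have [_ /negP] := hc v; apply; rewrite -euv; apply/mapP.
  by exists u; rewrite // mem_enum inE esym uv.
move=> u v uv; have [lt|lt|e'] := ltngtP (enum_rank u) (enum_rank v).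
- exact: main.
- by move=> e'; apply: (main v u); rewrite // esym.
- by move: uv; rewrite (enum_rank_inj (val_inj e')) eirr.
Qed.

(* A vertex of degree [d] has to avoid at most [d] colours of neighbours, [d] colours
   of incident edges and [d] values forced by the sums of its neighbours. *)
Lemma colour_low_vertices (T : finType) (e : rel T) (low : pred T) (cV : T -> nat)
    (cE : T -> T -> nat) (d k : nat) :
  symmetric e -> irreflexive e -> (forall v, low v -> deg e v <= d) -> 3 * d < k ->
  (forall v, ~~ low v -> 1 <= cV v <= k) ->
  (forall u v, e u v -> 1 <= cE u v <= k) ->
  (forall u v, e u v -> cE u v = cE v u) ->
  (forall u v w, e u v -> e u w -> v <> w -> cE u v <> cE u w) ->
  (forall u v, e u v -> ~~ low u -> ~~ low v -> cV u <> cV v) ->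
  (forall u v, e u v -> ~~ low u -> cE u v <> cV u) ->
  (forall u v, e u v -> ~~ low u -> ~~ low v ->
     weighted_deg e cV cE u <> weighted_deg e cV cE v) ->
  nsd_colourable e k.
Proof.
move=> esym eirr lowd dk rV rE sE pE pV pVE pS.
pose col (q : T -> nat) u := if low u then (q u).+1 else cV u.
pose sumE u := \sum_(w | e u w) cE u w.
(* The neighbours coloured before [v]: those that are not low, and the low ones of smaller rank. *)
pose seen v := [set u | e v u & ~~ low u || (enum_rank u < enum_rank v)].
pose forb q v := if low v then [seq (col q u).-1 | u <- enum (seen v)] ++
  [seq (cE v u).-1 | u <- enum [set u | e v u]] ++
  [seq (col q u + sumE u - sumE v).-1 | u <- enum (seen v)] else [::].
have [q hq] : exists q : T -> nat, forall v, q v < k /\ q v \notin forb q v.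
  apply: greedy_choice => [q q' v eqq|q v]; rewrite /forb; case: ifP => // lv.
  - have eqc u : u \in seen v -> col q u = col q' u.
      rewrite inE /col => /andP[_]; case: (low u) => //= lt; congr _.+1.
      by rewrite eqq.
    by congr (_ ++ (_ ++ _)); apply/eq_in_map => u; rewrite mem_enum => /eqc ->.
  - rewrite !size_cat !size_map -!cardE.
    have h1 : #|seen v| <= d.
      apply: leq_trans (lowd v lv); apply: subset_leq_card.
      by apply/subsetP => u; rewrite !inE => /andP[].
    by have := lowd v lv; rewrite /deg; lia.
  - by apply: leq_ltn_trans dk.
have qE v z : low v -> z \in forb q v -> q v <> z.
  by move=> lv zin qz; have [_] := hq v; rewrite qz zin.
have keyV u v : e u v -> low v -> (~~ low u || (enum_rank u < enum_rank v)) ->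
    col q u <> col q v /\ col q u + sumE u <> col q v + sumE v.
  move=> uv lv ok; have us : u \in seen v by rewrite inE esym uv.
  split=> h; apply: (qE v (q v) lv _ (erefl _)); rewrite /forb lv !mem_cat.
    apply/orP; left; apply/mapP; exists u; rewrite ?mem_enum // h /col lv //.
  apply/orP; right; apply/orP; right; apply/mapP; exists u; rewrite ?mem_enum //.
  by rewrite h /col lv addnK.
have key u v : e u v -> col q u <> col q v /\ col q u + sumE u <> col q v + sumE v.
  move=> uv; case: (boolP (low v)) => lv.
    case: (boolP (low u)) => lu; last by apply: keyV; rewrite ?lu.
    have [lt|lt|e'] := ltngtP (enum_rank u) (enum_rank v).
    - by apply: keyV; rewrite // lt orbT.
    - have [||h1 h2] := @keyV v u _ lu; first by rewrite esym.
      by rewrite lt orbT.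
      by split=> h; [apply: h1|apply: h2].
    - by move: uv; rewrite (enum_rank_inj (val_inj e')) eirr.
  case: (boolP (low u)) => lu.
    have [||h1 h2] := @keyV v u _ lu; first by rewrite esym.
      by rewrite lv.
    by split=> h; [apply: h1|apply: h2].
  rewrite /col (negbTE lu) (negbTE lv); split; first exact: pV.
  exact: pS.
have keyE u v : e u v -> cE u v <> col q u.
  move=> uv; rewrite /col; case: (boolP (low u)) => lu; last exact: pVE.
  move=> h; apply: (qE u (q u) lu _ (erefl _)); rewrite /forb lu !mem_cat.
  apply/orP; right; apply/orP; left; apply/mapP; exists v; last by rewrite h.
  by rewrite mem_enum inE.
exists (col q), cE; split; last split=> //; last split=> //; last split; last split=> //; last split.
- move=> v; rewrite /col; case: (boolP (low v)) => lv; last exact: rV.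
  by have [] := hq v.
- by move=> u v /key[].
- by move=> u v uv; split; [apply: keyE|rewrite sE //; apply: keyE; rewrite esym].
- by move=> u v /key[].
Qed.

(** * Random labels *)

Lemma sum_nat_bool (I : finType) (P b : pred I) :
  \sum_(i | P i) (b i : nat) = #|[set i | P i & b i]|.
Proof.
rewrite -sum1dep_card [RHS]big_mkcondr /=.
by apply: eq_bigr => i _; case: (b i).
Qed.

Lemma balanced_groups (T : finType) (e : rel T) (Dl D p : nat) :
  symmetric e -> (forall v, deg e v <= Dl) -> 0 < Dl -> D <= 2 * Dl -> 0 < p ->
  (INR (4 * Dl ^ 2 * (p * 2)) <= exp (INR D ^ 2 / (8 * INR Dl)))%R ->
  exists g : T -> 'I_p, forall v j,
    p * #|[set u | e v u & g u == j]| <= deg e v + p * D /\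
    deg e v <= p * #|[set u | e v u & g u == j]| + p * D.
Proof.
move=> esym degD Dl0 DDl p0 large.
(* The boolean complements the indicator of group [j.1], so that upper tails give both
   inequalities. *)
pose w (v : T) (j : 'I_p * bool) (u : T) (a : 'I_p) : nat := (a == j.1) (+) j.2.
have cardJ : #|{: 'I_p * bool}| = p * 2 by rewrite card_prod card_ord card_bool.
have [|||x hx] := @local_discrepancy T _ _ e w (fun=> 1) D Dl esym degD Dl0 DDl.
- by rewrite card_ord.
- by move=> v j u a; rewrite /w; case: addb.
- by rewrite cardJ.
exists x => v j.
have sum1 : \sum_(a < p) ((a == j) : nat) = 1.
  rewrite (bigD1 j) //= eqxx big1 ?addn0 // => a.
  by move/negbTE => ->.
have sum2 : \sum_(a < p) ((a != j) : nat) = p - 1.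
  have : \sum_(a < p) ((a == j) + (a != j)) = p.
    rewrite (eq_bigr (fun=> 1)) => [|a _]; last by case: (a == j).
    by rewrite sum1_card card_ord.
  rewrite big_split /= sum1; move: (\sum_(a < p) _) => s; lia.
have cards : #|[set u | e v u & x u == j]| + #|[set u | e v u & x u != j]| = deg e v.
  rewrite -!sum_nat_bool -big_split /= /deg -sum1dep_card.
  by apply: eq_bigr => u _; case: (x u == j).
have := hx v (j, false); have := hx v (j, true); rewrite /w /= card_ord.
rewrite (eq_bigr (fun u => (x u != j) : nat)) => [|u _]; last by rewrite addbT.
rewrite [X in _ <= X + _ -> _](eq_bigr (fun=> p - 1)) => [|u _]; last first.
  by rewrite -sum2; apply: eq_bigr => a _; rewrite addbT.
move=> h1.
rewrite (eq_bigr (fun u => (x u == j) : nat)) => [|u _]; last by rewrite addbF.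
rewrite [X in _ <= X + _ -> _](eq_bigr (fun=> 1)) => [|u _]; last first.
  by rewrite -sum1; apply: eq_bigr => a _; rewrite addbF.
move: h1; rewrite !sum_nat_bool !sum_nat_const !mul1n muln1.
have -> : #|[pred u | e v u]| = deg e v by rewrite /deg cardsE.
have : p * #|[set u | e v u & x u == j]| + p * #|[set u | e v u & x u != j]| = p * deg e v.
  by rewrite -mulnDr cards.
have : deg e v * (p - 1) + deg e v = p * deg e v by nia.
move: (deg e v * (p - 1)) (p * deg e v) (p * #|_|) (p * #|_|) (p * D) (deg e v).
by move=> *; lia.
Qed.

Lemma card_window (n C : nat) (A : {set 'I_n}) :
  {in A &, forall a b : 'I_n, b < a + C} -> #|A| <= C.
Proof.
case: (set_0Vmem A) => [->|[a0 a0A] h]; first by rewrite cards0.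
case: (@arg_minnP _ a0 (mem A) val a0A) => a aA mina.
rewrite cardE -(size_map val) -(size_iota a C); apply: uniq_leq_size.
  by rewrite map_inj_uniq ?enum_uniq //; apply: val_inj.
move=> _ /mapP[b bA ->]; rewrite mem_enum in bA.
by rewrite mem_iota (mina _ bA) (h a b).
Qed.

Lemma sum_ord_double n : 2 * \sum_(a < n) a = n * n.-1.
Proof.
elim: n => [|n IH]; first by rewrite big_ord0.
rewrite big_ord_recr /= mulnDr IH; case: n {IH} => //= n; nia.
Qed.

(** Here [cnf v b u a] is to mean that [v] with label [b] and [u] with label [a] risk equal sums.
    All conclusions are discrepancy bounds for one random pair of labels per vertex. The sum of the
    labels [y] is doubled because its mean is [deg eI v * (r - 1) / 2]. *)
Lemma shift_labels (T : finType) (e eI : rel T) (high : pred T)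
    (Dl D m dmin r C h B : nat) (cnf : T -> 'I_r -> T -> 'I_r -> bool) :
  symmetric e -> (forall v, deg e v <= Dl) -> 0 < Dl -> D <= 2 * Dl -> 0 < r ->
  subrel eI e -> (forall v, deg eI v <= m) -> (forall v, high v -> dmin <= deg eI v) ->
  (forall v b u, #|[set a | cnf v b u a]| <= C) ->
  m + r * D <= r * h -> C * Dl + r * D <= r * B ->
  C * dmin + r * r * D < r * dmin ->
  (INR (4 * Dl ^ 2 * (r + r + (r + r * r) + 2)) <= exp (INR D ^ 2 / (8 * INR Dl)))%R ->
  exists y z : T -> 'I_r, [/\
    forall v c, #|[set u | eI v u & y u == c]| <= h,
    forall v c, #|[set u | eI v u & z u == c]| <= h,
    forall v, 2 * \sum_(u | eI v u) y u <= deg eI v * r.-1 + 2 * r * D /\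
              deg eI v * r.-1 <= 2 * \sum_(u | eI v u) y u + 2 * r * D,
    forall v, #|[set u | e v u & cnf v (y v) u (y u)]| <= B &
    forall v, high v -> exists2 u, eI v u & (z u == z v) && ~~ cnf v (y v) u (y u)].
Proof.
move=> esym degD Dl0 DDl r0 sub degI highI cnfC hh hB hd large.
(* In order: sizes of the [y]-classes and of the [z]-classes, conflicts when [v] has label [b],
   inner neighbours unsuitable when [v] has labels [bc], and the two tails of the sum of [y]. The
   own label of [v] is random as well, so all its values are controlled at once and the actual one
   is inserted afterwards. *)
pose J : finType := (('I_r + 'I_r) + ('I_r + 'I_r * 'I_r) + bool)%type.
pose w (v : T) (j : J) (u : T) (a : 'I_r * 'I_r) : nat := match j with
  | inl (inl (inl c)) => eI v u && (a.1 == c)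
  | inl (inl (inr c)) => eI v u && (a.2 == c)
  | inl (inr (inl b)) => cnf v b u a.1
  | inl (inr (inr bc)) => eI v u && ~~ ((a.2 == bc.2) && ~~ cnf v bc.1 u a.1)
  | inr s => if eI v u then (if s then a.1 : nat else r.-1 - a.1) else 0
  end.
pose M (j : J) := if j is inr _ then r else 1.
have cardL : #|{: 'I_r * 'I_r}| = r * r by rewrite card_prod card_ord.
have cardJ : #|{: J}| = r + r + (r + r * r) + 2.
  by rewrite !card_sum card_prod card_bool !card_ord.
have [|||x hx] := @local_discrepancy T _ _ e w M D Dl esym degD Dl0 DDl.
- by rewrite cardL muln_gt0 r0.
- move=> v [[[c|c]|[b|bc]]|s] u a /=; try by case: (_ && _).
    by case: (cnf _ _ _ _).
  case: (eI v u) => //; case: s; first exact/ltnW.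
  by apply: leq_trans (leq_subr _ _) _; apply: leq_pred.
- by rewrite cardJ.
have sumI v (F : T -> nat) :
    \sum_(u | e v u) (if eI v u then F u else 0) = \sum_(u | eI v u) F u.
  rewrite -big_mkcondr /=; apply: eq_bigl => u.
  by rewrite andb_idl //; apply: sub.
have sumB v (b : pred T) : \sum_(u | e v u) ((eI v u && b u) : nat) =
    #|[set u | eI v u & b u]|.
  rewrite sum_nat_bool; apply: eq_card => u; rewrite !inE.
  by case: (boolP (eI v u)) => [/sub ->|_]; rewrite ?andbF.
have sumC v n : \sum_(u | eI v u) n = deg eI v * n by rewrite sum_nat_const /deg cardsE.
have sum1 c : \sum_(a < r) ((a == c) : nat) = 1.
  rewrite (bigD1 c) //= eqxx big1 ?addn0 // => a.
  by move/negbTE => ->.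
have sum2 (F G : 'I_r -> nat) : \sum_(a : 'I_r * 'I_r) F a.1 * G a.2 =
    (\sum_a F a) * (\sum_a G a).
  by rewrite big_distrlr /= pair_bigA.
have sum21 (F : 'I_r -> nat) : \sum_(a : 'I_r * 'I_r) F a.1 = r * \sum_a F a.
  rewrite mulnC (_ : _ * r = (\sum_a F a) * (\sum_(a < r) 1)); last first.
    by rewrite sum1_card card_ord.
  by rewrite -sum2; apply: eq_bigr => a _; rewrite muln1.
have sum22 (F : 'I_r -> nat) : \sum_(a : 'I_r * 'I_r) F a.2 = r * \sum_a F a.
  rewrite (_ : r * _ = (\sum_(a < r) 1) * (\sum_a F a)); last first.
    by rewrite sum1_card card_ord.
  by rewrite -sum2; apply: eq_bigr => a _; rewrite mul1n.
have bnd v n : r * r * n <= deg eI v * r + r * r * D -> n <= h.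
  move=> le; rewrite -(leq_pmul2l (_ : 0 < r * r)) ?muln_gt0 ?r0 //.
  apply: leq_trans le _; apply: (@leq_trans (r * (m + r * D))).
    by rewrite mulnDr mulnA leq_add2r mulnC leq_mul2l degI orbT.
  by rewrite -mulnA leq_mul2l hh orbT.
exists (fun v => (x v).1), (fun v => (x v).2); split.
- move=> v c; apply: (bnd v); have := hx v (inl (inl (inl c))).
  rewrite /w /= sumB cardL mul1n => le; apply: leq_trans le _; rewrite leq_add2r.
  rewrite -sumC -sumI; apply: leq_sum => u vu; case: (eI v u); last by rewrite big1.
  by rewrite (sum21 (fun a => (a == c) : nat)) sum1 muln1.
- move=> v c; apply: (bnd v); have := hx v (inl (inl (inr c))).
  rewrite /w /= sumB cardL mul1n => le; apply: leq_trans le _; rewrite leq_add2r.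
  rewrite -sumC -sumI; apply: leq_sum => u vu; case: (eI v u); last by rewrite big1.
  by rewrite (sum22 (fun a => (a == c) : nat)) sum1 muln1.
- move=> v; have := hx v (inr true); have := hx v (inr false); rewrite /w /= cardL !sumI.
  have e1 : \sum_(u | e v u) \sum_(a : 'I_r * 'I_r) (if eI v u then a.1 : nat else 0) =
      deg eI v * (r * \sum_(a < r) a).
    rewrite -sumC -sumI; apply: eq_bigr => u _.
    by case: (eI v u); [rewrite (sum21 (fun a => a : nat))|rewrite big1].
  have e2 : \sum_(u | e v u) \sum_(a : 'I_r * 'I_r) (if eI v u then r.-1 - a.1 else 0) =
      deg eI v * (r * \sum_(a < r) a).
    rewrite -sumC -sumI; apply: eq_bigr => u _.
    case: (eI v u); last by rewrite big1.
    rewrite (sum21 (fun a => r.-1 - a)); congr (r * _).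
    rewrite [RHS](reindex_inj rev_ord_inj) /=; apply: eq_bigr => a _.
    by rewrite -subn1 -subnDA add1n.
  have e3 : \sum_(u | eI v u) (r.-1 - (x u).1) + \sum_(u | eI v u) (x u).1 =
      deg eI v * r.-1.
    rewrite -big_split /= -sumC; apply: eq_bigr => u _.
    by rewrite subnK // -ltnS prednK.
  rewrite e1 e2; have := sum_ord_double r.
  move: e3; move: (\sum_(u | eI v u) _) (\sum_(u | eI v u) _) (\sum_(a < r) _) (deg eI v).
  move=> s1 s2 t dv e3 et h1 h2.
  have scale s : r * r * s <= dv * (r * t) + r * r * (r * D) ->
      2 * s <= dv * r.-1 + 2 * r * D.
    move=> le; rewrite -(leq_pmul2l (_ : 0 < r * r)) ?muln_gt0 ?r0 //.
    have := congr1 (muln (dv * r)) et; lia.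
  have {}h1 := scale _ h1; have {}h2 := scale _ h2; lia.
- move=> v; have := hx v (inl (inr (inl (x v).1))).
  rewrite /w /= sum_nat_bool cardL mul1n => le.
  rewrite -(leq_pmul2l (_ : 0 < r * r)) ?muln_gt0 ?r0 //; apply: leq_trans le _.
  apply: (@leq_trans (r * (C * Dl + r * D))); last by rewrite -mulnA leq_mul2l hB orbT.
  rewrite mulnDr !mulnA leq_add2r.
  apply: (@leq_trans (\sum_(u | e v u) r * C)); last first.
    rewrite sum_nat_const mulnC leq_mul2l.
    by have := degD v; rewrite /deg cardsE => ->; rewrite orbT.
  apply: leq_sum => u _.
  rewrite (sum21 (fun a => cnf v (x v).1 u a : nat)) leq_mul2l.
  by rewrite (sum_nat_bool xpredT) /= cnfC orbT.
- move=> v hv; have := hx v (inl (inr (inr (x v)))).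
  rewrite /w /= sumB cardL mul1n.
  (* If every inner neighbour were unsuitable, their number would be [deg eI v]. But at most
     [r * r - r + C] of the [r * r] label pairs are unsuitable, and the hypothesis on [dmin] makes
     the missing fraction exceed the deviation. *)
  case: (boolP [exists u, [&& eI v u, (x u).2 == (x v).2 & ~~ cnf v (x v).1 u (x u).1]]).
    by move=> /existsP[u /and3P[h1 h2 h3]] _; exists u; rewrite // h2.
  move/existsPn => none le; exfalso; move: le; apply/negP; rewrite -ltnNge.
  have -> : #|[set u | eI v u & ~~ (((x u).2 == (x v).2) && ~~ cnf v (x v).1 u (x u).1)]|
      = deg eI v.
    by apply: eq_card => u; rewrite !inE; have := none u; case: (eI v u).
  apply: (@leq_ltn_trans (deg eI v * (r * r - r + C) + r * r * D)).
    rewrite leq_add2r -sumC -sumI; apply: leq_sum => u vu.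
    case: (eI v u); last by rewrite big1.
    rewrite /= (sum_nat_bool xpredT) /=.
    set X : {set 'I_r * 'I_r} := finset _.
    have cardX : #|X| + #|[set a | ~~ cnf v (x v).1 u a]| = r * r.
      rewrite -cardL -(cardsC X); congr (_ + _).
      have inj : injective (fun a : 'I_r => (a, (x v).2)) by move=> a b [].
      rewrite -(card_imset _ inj); apply: eq_card => -[a1 a2]; rewrite !inE negbK.
      apply/imsetP/andP => [[a]|[/= /eqP -> hn]]; last by exists a1; rewrite ?inE.
      by rewrite inE => hn [-> ->]; rewrite eqxx.
    have cardN : #|[set a | cnf v (x v).1 u a]| + #|[set a | ~~ cnf v (x v).1 u a]| = r.
      rewrite -[RHS](card_ord r) -(cardsC [set a | cnf v (x v).1 u a]); congr (_ + _).
      by apply: eq_card => a; rewrite !inE.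
    have rr : r <= r * r by rewrite leq_pmulr.
    have := cnfC v (x v).1 u; move: cardX cardN rr; move: (r * r) #|_| #|_| #|_|.
    by move=> q a b c; lia.
  have := highI v hv; move: (deg eI v) => dv hdv.
  have ltC : C < r by case: (ltnP C r) => // le; have := leq_mul le (leqnn dmin); lia.
  have h1 : r * r * D < (r - C) * dv.
    by apply: leq_trans (leq_mul (leqnn _) hdv); rewrite mulnBl; lia.
  have rr : r <= r * r by rewrite leq_pmulr.
  have e1 : dv * (r * r - r + C) + (r - C) * dv = r * r * dv.
    rewrite [RHS]mulnC [(r - C) * _]mulnC -mulnDr; congr (_ * _).
    by move: (r * r) rr => q rr; lia.
  by move: e1 h1; move: (dv * _) (_ * dv) (_ * dv) (r * r * D) => *; lia.
Qed.

(** * The total colouring *)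

Lemma block_inj m a b x y : x < m -> y < m -> a * m + x = b * m + y -> a = b /\ x = y.
Proof.
move=> xm ym eq; have m0 : 0 < m by apply: leq_ltn_trans xm.
have := congr1 (divn^~ m) eq.
rewrite !divnMDl // !divn_small // !addn0 => eab; split=> //.
by move: eq; rewrite eab => /addnI.
Qed.

Lemma modn_addl_inj p i j k : j <= p -> k <= p ->
  (i + j) %% p.+1 = (i + k) %% p.+1 -> j = k.
Proof. by move=> jp kp /eqP; rewrite eqn_modDl !modn_small // => /eqP. Qed.

(* With [p + 1] blocks of [2 ^ k] colours, the edges between groups [i] and [j] use
   block [i + j] and the vertices of group [i] use block [i + p] modulo [p + 1]. *)
Lemma group_colouring (T : finType) (e : rel T) (p k : nat) (g : T -> 'I_p) :
  symmetric e -> irreflexive e ->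
  (forall v j, #|[set u | e v u & g u == j]| < 2 ^ k) ->
  exists (cV : T -> nat) (cO : T -> T -> nat), [/\
    (forall v, cV v < p.+1 * 2 ^ k) /\ (forall u v, e u v -> cV u <> cV v),
    forall u v, cO u v < p.+1 * 2 ^ k,
    forall u v, g u != g v -> cO u v = cO v u,
    forall u v, g u != g v -> cO u v <> cV u &
    forall u v w, e u v -> e u w -> g u != g v -> g u != g w -> v <> w ->
      cO u v <> cO u w].
Proof.
move=> esym eirr gk; set m := 2 ^ k.
have m0 : 0 < m by rewrite expn_gt0.
(* Edges between groups, oriented towards the larger index. Splitting each vertex according to the
   group of the other end makes all pairs of groups one bipartite graph, coloured by a single
   call. *)
pose E : finType := {x : T * T | e x.1 x.2 && (g x.1 < g x.2)}.
pose l (x : E) := ((val x).1, g (val x).2).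
pose r (x : E) := ((val x).2, g (val x).1).
have [||f [fm fl fr]] := @bipartite_edge_colouring k E _ _ l r.
- case=> u j; apply: leq_trans (ltnW (gk u j)).
  have inj : {in fibre l (u, j) &, injective (fun x : E => (val x).2)}.
    move=> x y; rewrite !inE => /eqP[ex _] /eqP[ey _] exy; apply: val_inj.
    by rewrite [val x]surjective_pairing [val y]surjective_pairing ex ey exy.
  rewrite -(card_in_imset inj); apply: subset_leq_card; apply/subsetP => v.
  move=> /imsetP[x + ->]; rewrite !inE => /eqP[<- <-]; rewrite eqxx andbT.
  by have /andP[] := valP x.
- case=> u j; apply: leq_trans (ltnW (gk u j)).
  have inj : {in fibre r (u, j) &, injective (fun x : E => (val x).1)}.
    move=> x y; rewrite !inE => /eqP[ex _] /eqP[ey _] exy; apply: val_inj.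
    by rewrite [val x]surjective_pairing [val y]surjective_pairing ex ey exy.
  rewrite -(card_in_imset inj); apply: subset_leq_card; apply/subsetP => v.
  move=> /imsetP[x + ->]; rewrite !inE => /eqP[<- <-]; rewrite eqxx andbT esym.
  by have /andP[] := valP x.
pose col u v := if insub (u, v) is Some x then f x else 0.
have colE u v (H : e u v && (g u < g v)) : col u v = f (Sub (u, v) H).
  by rewrite /col insubT.
have colm u v : col u v < m by rewrite /col; case: insubP.
pose cO u v := ((g u + g v) %% p.+1) * m + (if g u < g v then col u v else col v u).
(* Inside a group the degree is at most [m - 1], by the strict bound, so [m] colours suffice for its
   vertices. *)
have [q [qm qp]] : exists q : T -> nat, (forall v, q v < m) /\
    (forall u v, e u v -> g u = g v -> q u <> q v).
  have [|||q [q1 q2]] := @proper_vertex_colouring T (fun u v => e u v && (g u == g v)) m.-1.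
  - by move=> u v; rewrite esym eq_sym.
  - by move=> u; rewrite eirr.
  - move=> v; have := gk v (g v); rewrite -/m -{1}(prednK m0) ltnS.
    by apply: leq_trans; apply: subset_leq_card; apply/subsetP => u; rewrite !inE eq_sym.
  exists q; split=> [v|u v uv guv]; first by have := q1 v; rewrite prednK.
  by apply: q2; rewrite uv guv eqxx.
pose cV v := ((g v + p) %% p.+1) * m + q v.
have range a x : x < m -> (a %% p.+1) * m + x < p.+1 * m.
  move=> xm; have := ltn_pmod a (ltn0Sn p); move: (a %% _) => b bp.
  by apply: (@leq_trans (b.+1 * m)); [rewrite mulSn addnC ltn_add2r|rewrite leq_mul2r bp orbT].
have cm u v : (if g u < g v then col u v else col v u) < m by case: ifP.
have gp u : g u <= p by apply: ltnW.
exists cV, cO; split.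
- split=> [v|u v uv]; first exact: range.
  case/(block_inj (qm u) (qm v)) => + quv; rewrite ![_ + p]addnC.
  by move/modn_addl_inj => h; apply: (qp u v) => //; apply: val_inj; apply: h.
- by move=> u v; apply: range.
- move=> u v ne; congr (_ %% _ * _ + _); first exact: addnC.
  case: (ltngtP (g u) (g v)) => // e'.
  by rewrite (val_inj e') eqxx in ne.
- move=> u v ne; case/(block_inj (cm u v) (qm u)) => /modn_addl_inj h _.
  by have := ltn_ord (g v); rewrite h ?ltnn.
- move=> u v w uv uw nv nw vw; case/(block_inj (cm u v) (cm u w)) => /modn_addl_inj h.
  have {h} gvw : g v = g w by apply: val_inj; apply: h.
  rewrite -gvw; case: ltnP => [lt|ge].
    have Hv : e u v && (g u < g v) by rewrite uv.
    have Hw : e u w && (g u < g w) by rewrite uw -gvw.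
    rewrite (colE _ _ Hv) (colE _ _ Hw) => ef; apply: vw.
    have := fl _ _ _ ef; rewrite /l /= gvw => /(_ erefl) /(congr1 sval) /=.
    by case.
  have lt : g v < g u.
    by rewrite ltn_neqAle ge andbT; apply: contraNneq nv => /val_inj ->.
  have Hv : e v u && (g v < g u) by rewrite esym uv.
  have Hw : e w u && (g w < g u) by rewrite esym uw -gvw.
  rewrite (colE _ _ Hv) (colE _ _ Hw) => ef; apply: vw.
  have := fr _ _ _ ef; rewrite /r /= gvw => /(_ erefl) /(congr1 sval) /=.
  by case.
Qed.

(** At a vertex [v], the edges whose labels add up to [t] lead to neighbours of the single label
    [t - y v]. So each value of [t] gives a graph of degree at most [h], which needs only one block
    of [2 * h + 1] colours. *)
Lemma shifted_edge_colouring (T : finType) (eI : rel T) (r h : nat) (y : T -> 'I_r) :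
  symmetric eI -> irreflexive eI ->
  (forall v c, #|[set u | eI v u & y u == c]| <= h) ->
  exists c : T -> T -> nat, [/\ forall u v, c u v = c v u,
    forall u v, (y u + y v) * (2 * h).+1 <= c u v < (y u + y v).+1 * (2 * h).+1 &
    forall u v w, eI u v -> eI u w -> v <> w -> c u v <> c u w].
Proof.
move=> esym eirr yh.
pose et (t : 'I_(2 * r).+1) : rel T := fun u v => eI u v && (y u + y v == t).
have ex t : exists c : T -> T -> nat, [/\ forall u v, c u v = c v u,
    forall u v, c u v < (2 * h).+1 &
    forall u v w, et t u v -> et t u w -> v <> w -> c u v <> c u w].
  apply: proper_edge_colouring => [u v|u|v]; first by rewrite /et esym addnC.
    by rewrite /et eirr.
  rewrite /deg; case: (set_0Vmem [set u | et t v u]) => [->|[u0]]; first by rewrite cards0.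
  rewrite inE => /andP[_ /eqP e0]; apply: leq_trans (yh v (y u0)).
  apply: subset_leq_card; apply/subsetP => u; rewrite !inE => /andP[-> /eqP eu] /=.
  by apply/eqP/val_inj/(@addnI (y v)); rewrite /= eu e0.
have [c hc] := fin_all_exists ex.
pose ty u v : 'I_(2 * r).+1 := inord (y u + y v).
have tyE u v : ty u v = y u + y v :> nat.
  by rewrite inordK // mul2n -addnn ltnS; apply: leq_add; apply: ltnW.
exists (fun u v => (y u + y v) * (2 * h).+1 + c (ty u v) u v); split.
- move=> u v; have [sym _ _] := hc (ty u v).
  by rewrite sym (_ : ty v u = ty u v) ?(addnC (y v)) // /ty addnC.
- move=> u v; have [_ lt _] := hc (ty u v).
  by rewrite leq_addr (mulSn (y u + y v)) [ltnRHS]addnC ltn_add2l lt.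
- move=> u v w uv uw vw.
  have [_ ltv pv] := hc (ty u v); have [_ ltw _] := hc (ty u w).
  case/(block_inj (ltv u v) (ltw u w)) => es ec.
  have ety : ty u w = ty u v by rewrite /ty es.
  rewrite ety in ec; apply: (pv u v w) ec => //; first by rewrite /et uv tyE eqxx.
  by rewrite /et uw tyE es eqxx.
Qed.

(** [N] bounds the distance between twice the sum at a vertex and its predicted value. Its terms
    account for the deviation of the label sums, the position of a colour inside its block, and the
    recolouring of at most [h] edges per vertex. *)
Lemma nsd_of_parameters (T : finType) (e : rel T) (Dl D p k dmin r C h B : nat) :
  let m := 2 ^ k in let m2 := (2 * h).+1 in let Y := (2 * h + 2 * B).+1 in
  let N := 2 * (m2 * r * D + m * m2 + h * (2 * r * m2 + Y)) in
  symmetric e -> irreflexive e -> (forall v, deg e v <= Dl) ->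
  0 < Dl -> D <= 2 * Dl -> 0 < p -> 0 < r ->
  Dl + p * D < p * m -> 4 * p * dmin + 4 * p * D <= Dl ->
  m + r * D <= r * h -> C * Dl + r * D <= r * B -> C * dmin + r * r * D < r * dmin ->
  2 * N < m2 * dmin * C ->
  (INR (4 * Dl ^ 2 * (p * 2)) <= exp (INR D ^ 2 / (8 * INR Dl)))%R ->
  (INR (4 * Dl ^ 2 * (r + r + (r + r * r) + 2)) <= exp (INR D ^ 2 / (8 * INR Dl)))%R ->
  nsd_colourable e (p.+1 * m + 2 * r * m2 + Y).
Proof.
move=> m m2 Y N esym eirr degD Dl0 DDl p0 r0 hp hdmin hh hB hd hC large1 large2.
set K := _ + Y.
have [g hg] := balanced_groups esym degD Dl0 DDl p0 large1.
have gk v j : #|[set u | e v u & g u == j]| < 2 ^ k.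
  have [h1 _] := hg v j; rewrite -(ltn_pmul2l p0); apply: leq_ltn_trans h1 _.
  by apply: leq_ltn_trans hp; rewrite leq_add2r.
have [cV0 [cO [[cVm cVp] cOm cOs cOV cOp]]] := group_colouring esym eirr gk.
pose eI u v := e u v && (g u == g v).
have eIsym : symmetric eI by move=> u v; rewrite /eI esym eq_sym.
have eIirr : irreflexive eI by move=> u; rewrite /eI eirr.
have eIe : subrel eI e by move=> u v /andP[].
have degIE v : deg eI v = #|[set u | e v u & g u == g v]|.
  by apply: eq_card => u; rewrite !inE eq_sym.
have degI v : deg eI v <= m by rewrite degIE ltnW.
pose high v := Dl < 4 * deg e v.
have highI v : high v -> dmin <= deg eI v.
  move=> hv; have [_ h2] := hg v (g v); rewrite -degIE in h2.
  rewrite -(leq_pmul2l p0); move: hdmin hv h2; rewrite /high -!mulnA.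
  by move: (p * dmin) (p * D) (p * _) => *; lia.
(* Three consecutive palettes: below [beta] for vertices and edges between groups, from [beta] up to
   [gam] for inner edges, and from [gam] to [K] for the edges of [H]. *)
pose beta := (p.+1 * m).+1; pose gam := beta + 2 * r * m2.
pose A v := (cV0 v).+1 + \sum_(u | e v u && ~~ eI v u) (cO v u).+1 + beta * deg eI v.
(* Twice the sum expected at [v] when [v] gets the label [a]: its neighbours in the
   group have labels [(r - 1) / 2] on average. *)
pose S2 v (a : nat) := 2 * A v + m2 * deg eI v * (2 * a + r.-1).
pose cnf (v : T) (b : 'I_r) (u : T) (a : 'I_r) :=
  [&& high v, high u, S2 v b <= S2 u a + 2 * N & S2 u a <= S2 v b + 2 * N].
(* For fixed [v], [b] and [u], the conflicting values [S2 u a] lie within [4 * N] of each other,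
   while one step of [a] raises [S2] by at least [2 * m2 * dmin]; hence the labels lie in a window
   of length [C]. *)
have cnfC v b u : #|[set a | cnf v b u a]| <= C.
  apply: card_window => a a'; rewrite !inE => /and4P[_ hu h1 h2] /and4P[_ _ h3 h4].
  rewrite ltnNge; apply/negP => le.
  have {h1 h4} : S2 u a' <= S2 u a + 4 * N by lia.
  have := leq_mul (leq_mul (leqnn m2) (highI u hu)) le.
  rewrite /S2 mulnDr => h5; rewrite !(mulnDr (m2 * deg eI u)) in h5 * => h6.
  have h7 : m2 * dmin * C <= m2 * deg eI u * C by rewrite !leq_mul ?highI.
  have := leq_mul (leqnn (m2 * deg eI u)) le; rewrite mulnDr.
  move: h6 h7 hC; rewrite !(mulnCA _ 2).
  by move: (m2 * deg eI u * _) (m2 * deg eI u * _) (m2 * deg eI u * _) => *; lia.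
have [y [z [yh zh ysum yB yex]]] := shift_labels esym degD Dl0 DDl r0 eIe degI highI
  cnfC hh hB hd large2.
pose F u v := e u v && cnf u (y u) v (y v).
have Fsym : symmetric F.
  move=> u v; rewrite /F esym; congr (_ && _); rewrite /cnf.
  by apply/and4P/and4P => -[*]; split.
have Firr : irreflexive F by move=> u; rewrite /F eirr.
(* The inner edges recoloured last: equal second labels keep the degree at most [h], and removing
   [F] lets the greedy step separate the ends of [F]-edges. *)
pose H u v := [&& eI u v, z u == z v & ~~ F u v].
have Hsym : symmetric H by move=> u v; rewrite /H eIsym eq_sym Fsym.
have Hirr : irreflexive H by move=> u; rewrite /H eIirr.
have HI : subrel H eI by move=> u v /and3P[].
have degH v : deg H v <= h.
  apply: leq_trans (zh v (z v)); apply: subset_leq_card; apply/subsetP => u.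
  by rewrite !inE => /and3P[-> /eqP -> _]; rewrite eqxx.
have FH u v : F u v -> ~~ H u v by rewrite /H => ->; rewrite !andbF.
have highH v : high v -> exists u, H v u.
  move=> /yex[u vu /andP[/eqP zu nc]]; exists u.
  by rewrite /H vu zu eqxx /F negb_and nc orbT.
have Fex u v : F u v -> exists w, H u w by case/andP => _ /and4P[/highH].
have [cI [cIs cIb cIp]] := shifted_edge_colouring eIsym eIirr yh.
pose cE0 u v := if eI u v then beta + cI u v else (cO u v).+1.
(* The sum at [v] with every [H]-edge counted at the offset [gam]; the greedy colours [cH] are then
   pure increments. *)
pose base v := (cV0 v).+1 + \sum_(u | e v u && ~~ H v u) cE0 v u + \sum_(u | H v u) gam.
have [cH [cHs cHb cHp cHF]] := @greedy_edge_colouring T H F base h B _ Hsym Hirr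
  Fsym Firr degH yB FH Fex (ltnSn _).
pose cE u v := if H u v then gam + cH u v else cE0 u v.
pose cV v := (cV0 v).+1.
have sumE v : weighted_deg e cV cE v = base v + \sum_(u | H v u) cH v u.
  rewrite /weighted_deg (bigID (H v)) /= /base -/(cV v) -!addnA; congr (_ + _).
  rewrite addnC; congr (_ + _).
    by apply: eq_bigr => u /andP[_ /negbTE nH]; rewrite /cE nH.
  rewrite -big_split /=; apply: eq_big => u; last by case/andP => _ uH; rewrite /cE uH.
  by rewrite andb_idl // => /HI /eIe.
have near v : 2 * weighted_deg e cV cE v <= S2 v (y v) + N /\
    S2 v (y v) <= 2 * weighted_deg e cV cE v + N.
  have split_in (G : T -> nat) : \sum_(u | e v u) G u =
      \sum_(u | e v u && ~~ eI v u) G u + \sum_(u | eI v u) G u.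
    rewrite (bigID (eI v)) /= addnC; congr (_ + _); apply: eq_bigl => u.
    by rewrite andb_idl //; apply: eIe.
  have out : \sum_(u | e v u && ~~ eI v u) cE v u =
      \sum_(u | e v u && ~~ eI v u) (cO v u).+1.
    apply: eq_bigr => u /andP[_ /negbTE nI]; rewrite /cE /cE0 nI.
    by case: ifP => // /HI; rewrite nI.
  have sumC n : \sum_(u | eI v u) n = deg eI v * n by rewrite sum_nat_const /deg cardsE.
  (* [A v] already contains [beta] for each inner edge, so this amount is added on the left to avoid
     a subtraction. *)
  have wE : weighted_deg e cV cE v + beta * deg eI v = A v + \sum_(u | eI v u) cE v u.
    by rewrite /weighted_deg split_in out /A /cV; lia.
  have lin : \sum_(u | eI v u) (beta + (y v + y u) * m2) =
      beta * deg eI v + m2 * (deg eI v * y v) + m2 * \sum_(u | eI v u) y u.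
    under eq_bigr => u _ do rewrite mulnDl addnA.
    by rewrite big_split /= sumC -big_distrl /=; lia.
  have lower : \sum_(u | eI v u) (beta + (y v + y u) * m2) <= \sum_(u | eI v u) cE v u.
    apply: leq_sum => u vu; have /andP[lo _] := cIb v u.
    rewrite /cE /cE0 vu; case: ifP => _; last by rewrite leq_add2l.
    rewrite /gam -addnA leq_add2l; apply: leq_trans (leq_addr _ _).
    by rewrite leq_mul2r mul2n -addnn leq_add ?orbT // ltnW.
  have upper : \sum_(u | eI v u) cE v u <= \sum_(u | eI v u) (beta + (y v + y u) * m2) +
      (m * m2 + h * (2 * r * m2 + Y)).
    apply: (@leq_trans (\sum_(u | eI v u) (beta + (y v + y u) * m2) +
       (\sum_(u | eI v u) m2 + \sum_(u | eI v u) (if H v u then 2 * r * m2 + Y else 0)))).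
      rewrite -!big_split /=; apply: leq_sum => u vu; have /andP[_ up] := cIb v u.
      rewrite /cE /cE0 vu /gam; case: ifP => _.
        have := cHb v u; rewrite -/Y; lia.
      rewrite addn0 -addnA leq_add2l; apply: leq_trans (ltnW up) _.
      by rewrite (mulSn (y v + y u)) addnC.
    rewrite leq_add2l; apply: leq_add; first by rewrite sumC leq_mul2r degI orbT.
    rewrite -big_mkcondr /=.
    rewrite (eq_bigl (H v)) => [|u]; last by rewrite andb_idl //; apply: HI.
    by rewrite sum_nat_const leq_mul2r; have := degH v; rewrite /deg cardsE => ->; rewrite orbT.
  have [hy1 hy2] := ysum v.
  have hz1 := leq_mul (leqnn m2) hy1; have hz2 := leq_mul (leqnn m2) hy2.
  rewrite {}lin in lower upper; rewrite /S2 /N.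
  move: wE lower upper hz1 hz2.
  move: (\sum_(u | eI v u) cE v u) (\sum_(u | eI v u) y u) => s t.
  move: (weighted_deg _ _ _ _) (A v) (h * _) (m * m2) (beta * _) => W a q1 q2 q3.
  move: (deg eI v) (y v : nat) => dv b; clear.
  by split; lia.
have mK : p.+1 * m <= K by rewrite /K -addnA leq_addr.
have inb u v : cI u v < 2 * r * m2.
  have /andP[_] := cIb u v; move=> h1; apply: leq_trans h1 _; rewrite leq_mul2r.
  by have := ltn_ord (y u); have := ltn_ord (y v); lia.
have outR u v : (cO u v).+1 < beta by rewrite ltnS.
have inR u v : beta <= beta + cI u v < gam by rewrite leq_addr ltn_add2l inb.
have HR u v : gam <= gam + cH u v <= K.
  by rewrite leq_addr /=; have := cHb u v; rewrite -/Y /gam /beta /K; lia.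
apply: (@colour_low_vertices T e (fun v => ~~ high v) cV cE (Dl %/ 4)) => //.
- by move=> v; rewrite -leqNgt leq_divRL // mulnC.
- have h1 := leq_divM Dl 4; have h2 : p * m <= p.+1 * m by rewrite leq_mul2r leqnSn orbT.
  by move: hp mK; move: (p * m) (p.+1 * m) h2 (p * D) => *; lia.
- by move=> v _; rewrite /cV /=; apply: leq_trans mK.
- move=> u v uv; rewrite /cE /cE0; have := HR u v; have := inR u v; have := outR u v.
  have gamK : gam <= K by case/andP: (HR u v) => h1; apply: leq_trans.
  by have := leqW mK; case: ifP => _; [|case: ifP => _]; rewrite /beta; lia.
- move=> u v uv; rewrite /cE /cE0 Hsym eIsym cHs cIs; case: ifP => // _.
  by case: ifP => // /negbT; rewrite /eI esym uv /= eq_sym => /cOs ->.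
- move=> u v w uv uw vw; rewrite /cE /cE0.
  have := inR u v; have := inR u w; have := outR u v; have := outR u w.
  have := HR u v; have := HR u w.
  case: (boolP (H u v)) => Huv; case: (boolP (H u w)) => Huw.
  + by move=> _ _ _ _ _ _ /addnI; apply: cHp vw.
  + by case: ifP => _; lia.
  + by case: ifP => _; lia.
  case: (boolP (eI u v)) => Iuv; case: (boolP (eI u w)) => Iuw.
  + by move=> _ _ _ _ _ _ /addnI; apply: cIp vw.
  + by lia.
  + by lia.
  move=> _ _ _ _ _ _ [] ec; apply: (cOp u v w) ec => //.
    by move: Iuv; rewrite /eI uv.
  by move: Iuw; rewrite /eI uw.
- by move=> u v uv _ _ [] /cVp; apply.
- move=> u v uv _; rewrite /cE /cE0 /cV.
  have := inR u v; have := HR u v; have cVb : (cV0 u).+1 < beta by rewrite ltnS.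
  case: ifP => _; first lia.
  case: ifP => [_|/negbT nI _ _ [] ec]; first lia.
  by apply: (cOV u v) ec; move: nI; rewrite /eI uv.
- move=> u v uv /negPn hu /negPn hv.
  case: (boolP (F u v)) => [Fuv|nF]; first by rewrite !sumE; apply: cHF.
  (* Equal sums put both predictions within [N] of the same number, which is a conflict and would
     make the edge belong to [F]. *)
  move=> eW; move: nF; rewrite /F uv /cnf hu hv /= => /negP; apply.
  by have := near u; have := near v; rewrite eW; lia.
Qed.

(** * Choice of the parameters *)

(** Bernoulli's inequality for [(1 - 1 / (b + 1)) ^ n], with denominators cleared. *)
Lemma bernoulli_nat b n : n <= b.+1 -> b.+1 ^ n * (b.+1 - n) <= b ^ n * b.+1.
Proof.
elim: n => [|n IH] nb; first by rewrite !expn0 subn0.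
have {}IH := leq_mul (leqnn b) (IH (ltnW nb)).
rewrite [b ^ _.+1]expnS -mulnA; apply: leq_trans IH.
rewrite expnS -mulnA mulnCA [in leqRHS]mulnCA leq_mul2l; apply/orP; right.
by rewrite !mulnBr; nia.
Qed.

(** Take [b] to be the integer part of the 30th root. Bernoulli bounds the ratio of consecutive 30th
    powers by [(b + 1) / (b - 29)], which is at most 2 exactly from [b = 59] on. *)
Lemma root30_bounds n0 n : 59 <= n0 -> n0 ^ 30 <= n ->
  exists2 b, n0 <= b & b ^ 30 <= n <= 2 * b ^ 30.
Proof.
move=> n059 le.
have bounded b : b ^ 30 <= n -> b <= n.
  by apply: leq_trans; case: b => // b; rewrite -{1}[b.+1]expn1 leq_pexp2l.
case: (ex_maxnP (ex_intro (fun b => b ^ 30 <= n) n0 le) bounded) => b bn bmax.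
have n0b : n0 <= b by apply: bmax.
exists b => //; rewrite bn /=.
have ltn : n < b.+1 ^ 30 by rewrite ltnNge; apply/negP => /bmax; rewrite ltnn.
apply: leq_trans (ltnW ltn) _.
have b59 : 59 <= b := leq_trans n059 n0b.
have b30 : 30 <= b.+1 by apply: leq_trans (leqW b59).
have := bernoulli_nat b30; move: (b.+1 ^ 30) (b ^ 30) => u v.
move: b59; clear => b59 h; rewrite -(leq_pmul2r (_ : 0 < b.+1 - 30)); last by lia.
apply: leq_trans h _; rewrite (mulnC 2) -mulnA leq_mul2l; apply/orP; right; lia.
Qed.

Lemma INR_expn b n : INR (b ^ n) = (INR b ^ n)%R.
Proof. by elim: n => // n IH; rewrite expnS INR_muln IH. Qed.

Lemma exp_mulr_INR x n : exp (INR n * x) = (exp x ^ n)%R.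
Proof.
elim: n => [|n IH]; first by rewrite /= Rmult_0_l exp_0.
by rewrite S_INR Rmult_plus_distr_r exp_plus IH Rmult_1_l /= Rmult_comm.
Qed.

(** With [x = b^2 / (16 n)] one has [b <= x <= exp x], and the [n]-th power gives the claim. *)
Lemma expn_le_exp b n : 16 * n <= b -> 0 < n ->
  (INR (b ^ n) <= exp (INR b ^ 2 / 16))%R.
Proof.
move=> nb n0; have rn := INR_ltn0 n0.
have := INR_leq nb; rewrite INR_muln (_ : INR 16 = 16%R); last by rewrite /=; lra.
move=> rb; set x := (INR b ^ 2 / (16 * INR n))%R.
have -> : (INR b ^ 2 / 16 = INR n * x)%R by rewrite /x; field; lra.
rewrite exp_mulr_INR INR_expn; apply: pow_incr; split; first exact: pos_INR.
apply: (@Rle_trans _ x); last by have := exp_ineq1_le x; lra.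
apply: (Rmult_le_reg_r (16 * INR n)); first lra.
have -> : (x * (16 * INR n) = INR b * INR b)%R by rewrite /x; field; lra.
by apply: Rmult_le_compat_l; [apply: pos_INR|].
Qed.

(** The left side is at most [16 * b ^ 75 <= b ^ 80], the exponent on the right at least
    [b ^ 2 / 16], and [b] exceeds [16 * 80]. *)
Lemma exp_large b Dl X : 2000 <= b -> 0 < Dl -> Dl <= 2 * b ^ 30 -> X <= b ^ 15 ->
  (INR (4 * Dl ^ 2 * X) <= exp (INR (b ^ 16) ^ 2 / (8 * INR Dl)))%R.
Proof.
move=> b0 Dl0 DlU XU.
have b1 : 0 < b by apply: leq_trans b0.
apply: (@Rle_trans _ (INR (b ^ 80))).
  apply: INR_leq; apply: (@leq_trans (4 * (2 * b ^ 30) ^ 2 * b ^ 15)).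
    by apply: leq_mul => //; rewrite leq_mul2l leq_exp2r.
  rewrite expnMn -expnM (_ : b ^ 80 = b ^ 5 * b ^ (30 * 2) * b ^ 15); last by rewrite -!expnD.
  rewrite mulnA; apply: leq_mul => //; apply: leq_mul => //.
  by apply: (@leq_trans (b ^ 1)); [rewrite expn1; apply: leq_trans b0|rewrite leq_pexp2l].
apply: Rle_trans (expn_le_exp (_ : 16 * 80 <= b) _) _ => //; first exact: leq_trans b0.
have rDl := INR_ltn0 Dl0; have rb := INR_ltn0 b1.
have h : (INR b ^ 2 / 16 <= INR (b ^ 16) ^ 2 / (8 * INR Dl))%R.
  apply: (Rmult_le_reg_r (8 * INR Dl)); first lra.
  have -> : (INR (b ^ 16) ^ 2 / (8 * INR Dl) * (8 * INR Dl) = INR b ^ 2 * INR b ^ 30)%R.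
    by rewrite INR_expn; field; lra.
  have := INR_leq DlU; rewrite INR_muln INR_expn (_ : INR 2 = 2%R) // => le.
  have : (0 <= INR b ^ 2)%R by apply: pow2_ge_0.
  move: (INR b ^ 2)%R (INR b ^ 30)%R le => s t le s0; nra.
have [lt|->] : (INR b ^ 2 / 16 < INR (b ^ 16) ^ 2 / (8 * INR Dl) \/
   INR b ^ 2 / 16 = INR (b ^ 16) ^ 2 / (8 * INR Dl))%R by lra.
  exact/Rlt_le/exp_increasing.
exact: Rle_refl.
Qed.

Lemma nsd_colourable_upper (T : finType) (e : rel T) (b Dl : nat) :
  symmetric e -> irreflexive e -> (forall v, deg e v <= Dl) ->
  2000 <= b -> b ^ 30 <= Dl <= 2 * b ^ 30 ->
  exists2 k, nsd_colourable e k & k <= Dl + b ^ 25.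
Proof.
move=> esym eirr degD b0 /andP[DlL DlU].
have b1 : 0 < b by apply: leq_trans b0.
have Dl0 : 0 < Dl by apply: leq_trans DlL; rewrite expn_gt0 b1.
have large X := @exp_large b Dl X b0 Dl0 DlU.
(* [lia] must not see the large exponents. *)
have [P eP] : exists P : nat -> nat, forall n, b ^ n = P n by exists (expn b).
rewrite !eP in DlL DlU large *.
have PS n : P n.+1 = b * P n by rewrite -!eP expnS.
have PD n n' : P (n + n') = P n * P n' by rewrite -!eP expnD.
have Ppos n : 0 < P n by rewrite -eP expn_gt0 b1.
have P_le n n' : n <= n' -> P n <= P n' by move=> le; rewrite -!eP leq_pexp2l.
have gap n : 2000 * P n <= P n.+1 by rewrite PS leq_mul2r b0 orbT.
have b24 : 1 < P 24 by apply: leq_trans (gap 23); have := Ppos 23; lia.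
have [k kL kU] : exists2 k, P 24 <= 2 ^ k & 2 ^ k <= 2 * P 24.
  have /andP[kU kL] := up_log_bounds (isT : 1 < 2) b24.
  exists (up_log 2 (P 24)) => //; move: kU kL.
  case: (up_log 2 (P 24)) => [|k] /= kU _; first exact: leq_trans (ltnW b24) (leq_pmull _ _).
  by rewrite expnS leq_mul2l ltnW.
have [m em] : exists m, m = 2 ^ k by exists (2 ^ k).
rewrite -em in kL kU.
(* [p], [h] and [B] are rounded up just enough for their defining inequalities. [dmin] is about half
   the mean inner degree of a vertex of degree [Dl / 4]. [C] has to exceed 512, the constant in the
   comparison of [2 * N] with [m2 * dmin] below. *)
pose D := P 16; pose r := P 7; pose C := 600.
pose p := (Dl %/ (m - D)).+1; pose h := (m %/ r).+1 + D.
pose B := ((C * Dl) %/ r).+1 + D; pose dmin := m %/ 8.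
have rD : r * D = P 23 by rewrite -PD.
have P30 : P 30 = r * P 23 by rewrite -PD.
have g6 := gap 6; have g15 := gap 15; have g21 := gap 21; have g22 := gap 22.
have g23 := gap 23; have g24 := gap 24; have g29 := gap 29.
have l1 := P_le 6 21 isT; have l2 := P_le 7 22 isT; have l3 := P_le 16 22 isT.
have l4 := P_le 17 22 isT; have l5 := P_le 24 29 isT.
have DmD : 2 * D <= m by rewrite /D; lia.
have pD1 : Dl < p * (m - D) by apply: ltn_ceil; lia.
have pD2 : p * (m - D) <= Dl + (m - D) by rewrite /p mulSn addnC leq_add2r leq_divM.
have pU : p <= 5 * P 6.
  rewrite -(leq_pmul2r (Ppos 24)) -mulnA -PD.
  have : p * P 24 <= 2 * (p * (m - D)).
    by rewrite mulnCA leq_mul2l; apply/orP; right; lia.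
  by move: pD2; rewrite -[6 + 24]/30; move: (p * _) (p * _) => *; lia.
have pDU : p * D <= 5 * P 22.
  by apply: leq_trans (leq_mul pU (leqnn _)) _; rewrite -mulnA -PD.
have pmE : p * (m - D) + p * D = p * m by rewrite -mulnDr subnK //; lia.
have hr : r * h <= 2 * m.
  rewrite /h mulnDr rD mulnS; have := leq_divM m r; rewrite mulnC /r; lia.
have hL : m + r * D <= r * h.
  by rewrite /h mulnDr leq_add2r [leqRHS]mulnC; apply: ltnW; apply: ltn_ceil; apply: Ppos.
have rB : r * B <= C * Dl + r + r * D.
  by rewrite /B mulnDr leq_add2r mulnS addnC leq_add2r [leqLHS]mulnC leq_divM.
have BL : C * Dl + r * D <= r * B.
  by rewrite /B mulnDr leq_add2r [leqRHS]mulnC; apply: ltnW; apply: ltn_ceil; apply: Ppos.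
have BU : B <= P 24.
  rewrite -(leq_pmul2l (Ppos 7)) -/r; apply: leq_trans rB _.
  have : 2000 * (r * P 23) <= r * P 24 by rewrite mulnCA leq_mul2l g23 orbT.
  rewrite rD; have : r <= r * P 23 by rewrite leq_pmulr.
  have : P 23 <= r * P 23 by rewrite leq_pmull // Ppos.
  move: DlU; rewrite P30 /C; move: (r * P 23) (r * P 24) => *; lia.
have d1 : 8 * dmin <= m by rewrite mulnC leq_divM.
have d2 : m < 8 * dmin + 8.
  by have := ltn_ceil m (isT : 0 < 8); rewrite -/dmin mulSn; lia.
have r2000 : 2000 <= r by rewrite /r PS; apply: leq_trans b0 (leq_pmulr _ _).
have hU : 2000 * h <= 2 * m by apply: leq_trans hr; rewrite leq_mul2r r2000 orbT.
(* The main term [p * m] is at most [Dl + m + 5 * b ^ 22]. The extra block, the inner palette and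
   the last palette are all of order [b ^ 24], and [b ^ 25 >= 2000 * b ^ 24] absorbs them. *)
exists (p.+1 * 2 ^ k + 2 * r * (2 * h).+1 + (2 * h + 2 * B).+1); last first.
  rewrite -em mulSn; have : r * (2 * h).+1 = 2 * (r * h) + r by rewrite mulnS mulnCA addnC.
  rewrite -mulnA.
  have {gap PS PD Ppos P_le} := pD2; move: pmE pDU hr.
  move: (p * m) (p * D) (p * (m - D)) (r * h) (r * _) => *.
  lia.
apply: (@nsd_of_parameters T e Dl D p k dmin r C h B) => //.
- by rewrite /D; have := P_le 16 30 isT; lia.
- exact: Ppos.
- by rewrite -em -pmE ltn_add2r.
- have h1 := leq_mul (leqnn p) d1; rewrite -!mulnA.
  move: h1 pmE pD2 pDU; rewrite (mulnCA p 8).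
  by move: (p * dmin) (p * D) (p * m) (p * (m - D)) => *; lia.
- by rewrite -em.
- rewrite -mulnA rD.
  have h1 : 2000 * dmin <= r * dmin by rewrite leq_mul2r r2000 orbT.
  have h2 : 125 * P 23 <= dmin by have := Ppos 23; lia.
  have := leq_mul (leqnn r) h2; rewrite mulnCA.
  have : 0 < r * P 23 by rewrite muln_gt0 !Ppos.
  by move: h1; rewrite /C; move: (r * dmin) (r * P 23) => *; lia.
(* Each of the five contributions is a multiple of [m2 * m], with coefficients adding up to 8. Hence
   [2 * N <= 32 * (m2 * m)], and [m <= 16 * dmin] turns this into 512. *)
- rewrite -em; set m2 := (2 * h).+1.
  have m16 : m <= 16 * dmin by have := Ppos 23; lia.
  have h1 : m2 * r * D <= m2 * m by rewrite -mulnA rD leq_mul2l; apply/orP; right; lia.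
  have h2 : h * (2 * r * m2) <= 4 * (m2 * m).
    have := leq_mul (leqnn m2) hr; rewrite (mulnCA m2 2).
    by rewrite (_ : h * (2 * r * m2) = 2 * (m2 * (r * h))); lia.
  have h3 : h * m2 <= m2 * m by rewrite mulnC leq_mul2l; apply/orP; right; lia.
  have h4 : h * (2 * B) <= m2 * m.
    by rewrite mulnCA mulnA; apply: leq_mul; rewrite ?leqnSn // (leq_trans BU).
  have h5 : m2 * m <= m2 * dmin * 16 by rewrite -mulnA (mulnC dmin) leq_mul2l m16 orbT.
  have h6 : 0 < m2 * m by rewrite muln_gt0 /=; have := Ppos 24; lia.
  have -> : h * (2 * r * m2 + (2 * h + 2 * B).+1) =
      h * (2 * r * m2) + (h * m2 + h * (2 * B)) by rewrite -(mulnDr h m2) -(mulnDr h (2 * r * m2)).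
  rewrite (mulnC m m2) /C; move: h1 h2 h3 h4 h5 h6.
  by move: (m2 * m) (m2 * r * D) (h * _) (h * m2) (h * _) (m2 * dmin); clear => *; lia.
- have g14 := gap 14; have le14 := P_le 6 14 isT.
  by apply: large; lia.
- have g14 := gap 14; have le14 := P_le 7 14 isT; have pos14 := Ppos 14.
  by apply: large; rewrite -PD -/(P 14) /r; lia.
Qed.

(** * The least number of colours and the real bound *)

Lemma tnsd_number_le (T : finType) (e : rel T) (k : nat) :
  nsd_colourable e k -> exists2 k', is_tnsd_number e k' & k' <= k.
Proof.
elim/ltn_ind: k => k IH ck.
have [[k' [ltk ck']]|none] := classic (exists k', k' < k /\ nsd_colourable e k').
  by have [k2 h2 le] := IH _ ltk ck'; exists k2; rewrite // (leq_trans le) // ltnW.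
exists k => //; split=> // k' ck'; rewrite leqNgt; apply/negP => ltk.
by apply: none; exists k'.
Qed.

Lemma Rpower_ge_pow25 b n : 0 < b -> b ^ 30 <= n ->
  (INR (b ^ 25) <= Rpower (INR n) (5 / 6))%R.
Proof.
move=> b0 /INR_leq; rewrite !INR_expn => le.
have rb := INR_ltn0 b0.
have <- : Rpower (INR b ^ 30) (5 / 6) = (INR b ^ 25)%R.
  rewrite -!Rpower_pow // Rpower_mult; congr (Rpower _ _).
  by rewrite /=; field.
apply: Rle_Rpower_l; first lra.
by split=> //; apply: pow_lt.
Qed.

Lemma Rpower_ln_ge1 n (c : R) : 3 <= n -> (0 <= c)%R -> (1 <= Rpower (ln (INR n)) c)%R.
Proof.
move=> /INR_leq n3 c0; rewrite (_ : INR 3 = 3%R) in n3; last by rewrite /=; lra.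
have ln1 : (1 <= ln (INR n))%R.
  rewrite -[X in (X <= _)%R]ln_exp.
  have := exp_le_3 => e3; have [lt|->] : (exp 1 < INR n \/ exp 1 = INR n)%R by lra.
    by apply/Rlt_le/ln_increasing => //; apply: exp_pos.
  exact: Rle_refl.
have <- : Rpower 1 c = 1%R by rewrite /Rpower ln_1 Rmult_0_r exp_0.
by apply: Rle_Rpower_l; lra.
Qed.

Theorem mainTheorem1 :
  exists Delta0 : nat,
  forall (T : finType) (e : rel T),
    simple_graph e ->
    (Delta0 <= max_deg e)%N ->
    exists k : nat,
      is_tnsd_number e k /\
      (INR k <= INR (max_deg e)
                + 139 * Rpower (INR (max_deg e)) (5 / 6)
                      * Rpower (ln (INR (max_deg e))) (1 / 6))%R.
Proof.
exists (2000 ^ 30) => T e [esym eirr] large.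
have degD v : deg e v <= max_deg e by apply: (leq_bigmax v).
move: (max_deg e) large degD => n large degD.
have [b b0 /andP[bn nb]] := root30_bounds (isT : 59 <= 2000) large.
have b1 : 0 < b by apply: leq_trans b0.
have [k0 ck0 k0U] : exists2 k, nsd_colourable e k & k <= n + b ^ 25.
  by apply: nsd_colourable_upper; rewrite // bn nb.
have [k ck kU] := tnsd_number_le ck0; exists k; split=> //.
have := INR_leq (leq_trans kU k0U); rewrite INR_addn.
have n3 : 3 <= n.
  apply: leq_trans bn; apply: leq_trans (leq_trans (isT : 3 <= 2000) b0) _.
  by rewrite -{1}[b]expn1 leq_pexp2l.
(* The excess [b ^ 25] is at most the power 5/6 of the maximum degree, and the logarithmic factor is
   at least 1. *)
have := Rpower_ge_pow25 b1 bn; have := @Rpower_ln_ge1 n (1 / 6)%R n3.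
have := pos_INR (b ^ 25).
move: (INR (b ^ 25)) (Rpower _ (5 / 6)) (Rpower _ (1 / 6)) => x y z x0 h1 h2 h3.
have {}h1 : (1 <= z)%R by apply: h1; lra.
nra.
Qed.
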